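(* Let $\Gamma$ be a countable (discrete) amenable group and let $f\in\mathbb{Z}\Gamma$ be invertible in $\mathcal{L}\Gamma$. Then $\mathrm{h}(\alpha_f)=\mathrm{h}(\alpha_{f^*})$.
   Context: $f^*\in\mathbb{Z}\Gamma$ is defined by $(f^* )_\gamma=f_{\gamma^{-1}}$. $\mathcal{L}\Gamma$ is the left group von Neumann algebra: the strong operator closure in $B(\ell^2(\Gamma))$ of $\mathbb{C}\Gamma$ acting by left multiplication (convolution). For $f\in\mathbb{Z}\Gamma$, $X_f$ is the Pontryagin dual of $\mathbb{Z}\Gamma/\mathbb{Z}\Gamma f$ and $\alpha_f$ is the action of $\Gamma$ on $X_f$ dual to left translation. Explicitly, $X_f$ is identified with the set of $h\in(\mathbb{R}/\mathbb{Z})^\Gamma$ with $\sum_\gamma f_\gamma h_{\gamma^{-1}\gamma'}=0$ for all $\gamma'\in\Gamma$, and $\alpha_f$ with the restriction of the right shift $(\gamma h)_{\gamma'}=h_{\gamma'\gamma}$. $\mathrm{h}(\alpha_f)$ is its topological entropy (equal to its measure entropy for normalized Haar measure), where for an action $\alpha$ on a compact space, $\mathrm{h}_{\rm top}(\alpha)=\sup_{\mathcal{U}}\lim_n\frac{1}{|F_n|}\log N(\bigvee_{\gamma\in F_n}\gamma^{-1}\mathcal{U})$, the supremum over finite open covers, $N$ denoting the minimal cardinality of a subcover and $\{F_n\}$ any left Følner sequence (nonempty finite sets with $|KF_n\Delta F_n|/|F_n|\to0$ for every finite $K\subseteq\Gamma$). *)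

(* Defs.v *)
From HB Require Import structures.
From mathcomp Require Import all_boot all_order all_algebra finmap complex.
From mathcomp Require Import all_classical all_reals all_analysis.
From mathcomp Require Import ring.

Set Implicit Arguments.
Unset Strict Implicit.
Unset Printing Implicit Defensive.

Import Order.TTheory GRing.Theory Num.Theory.
Import numFieldNormedType.Exports.

Local Open Scope classical_set_scope.
Local Open Scope ring_scope.

Definition fsymdiff (T : choiceType) (A B : {fset T}) : {fset T} :=
  ((A `\` B) `|` (B `\` A))%fset.

Definition fset_mulg (G : groupType) (K F : {fset G}) : {fset G} :=
  [fset (k * x)%g | k in K, x in F]%fset.

(* The set K has to be nonempty: for K = fset0 the ratio below is
   constantly 1. *)
Definition left_folner (R : realType) (G : groupType) (F : nat -> {fset G}) :=
  (forall n, F n != fset0) /\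
  forall K : {fset G}, K != fset0 ->
    (#|` fsymdiff (fset_mulg K (F n)) (F n)|%:R / #|` F n|%:R : R)
      @[n --> \oo] --> (0 : R).

Definition amenable (R : realType) (G : groupType) :=
  exists F : nat -> {fset G}, left_folner R F.

Definition finite_open_cover (X : topologicalType) (U : set (set X)) :=
  [/\ finite_set U, U `<=` open & \bigcup_(A in U) A = setT].

Definition subcovers (X : Type) (V : set (set X)) : set {fset set X} :=
  [set W : {fset set X} | [set` W] `<=` V /\ \bigcup_(A in [set` W]) A = setT].

Definition cover_number (R : realType) (X : Type) (V : set (set X)) : R :=
  inf [set #|` W|%:R | W in subcovers V].
Arguments cover_number R {X} V.

(* The elements of the join of the g^-1 U, g in F, are the intersections of
   the g^-1 (c g), where the choice c picks a member of U for each g in F. *)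
Definition cover_join (G : choiceType) (X : Type) (a : G -> X -> X)
    (F : {fset G}) (U : set (set X)) : set (set X) :=
  [set \bigcap_(g in [set` F]) (a g @^-1` c g) |
     c in [set c : G -> set X | forall g, g \in F -> U (c g)]].

(* For an action on a compact space, this limit exists and does not depend on
   the left Folner sequence F (Ornstein-Weiss). *)
Definition cover_entropy (R : realType) (G : choiceType) (X : Type)
    (F : nat -> {fset G}) (a : G -> X -> X) (U : set (set X)) : \bar R :=
  limn (fun n =>
    (ln (cover_number R (cover_join a (F n) U)) / #|` F n|%:R)%:E).
Arguments cover_entropy R {G X} F a U.

Definition htop (R : realType) (G : choiceType) (X : topologicalType)
    (F : nat -> {fset G}) (a : G -> X -> X) : \bar R :=
  ereal_sup [set cover_entropy R F a U | U in @finite_open_cover X].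
Arguments htop R {G X} F a.

Notation ZGamma G := {fsfun G -> int with (0 : int)}.
Notation CGamma R G := {fsfun G -> R[i] with (0 : R[i])}.

Definition star (G : groupType) (f : ZGamma G) : ZGamma G :=
  [fsfun g in [fset (h^-1)%g | h in finsupp f]%fset => f (g^-1)%g].

Lemma starE (G : groupType) (f : ZGamma G) (g : G) : star f g = f (g^-1)%g.
Proof.
rewrite /star fsfun_fun; case: ifPn => // /imfsetP gf.
case: finsuppP => // gf'; exfalso; apply: gf.
by exists (g^-1)%g => //; rewrite invgK.
Qed.

Definition complexify (R : realType) (G : groupType) (f : ZGamma G) :
  CGamma R G := [fsfun g in finsupp f => (f g)%:~R].
Arguments complexify R {G} f.

Lemma complexifyE (R : realType) (G : groupType) (f : ZGamma G) (g : G) :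
  complexify R f g = (f g)%:~R.
Proof. by rewrite /complexify fsfun_fun; case: finsuppP. Qed.

Definition RmodZ (R : realType) : Type :=
  quotient_topology {ideal_quot (@Num.int_num_subdef R : {pred R})}.

HB.instance Definition _ (R : realType) := Topological.copy (RmodZ R)
  (quotient_topology {ideal_quot (@Num.int_num_subdef R : {pred R})}).

HB.instance Definition _ (R : realType) :=
  let Q := {ideal_quot (@Num.int_num_subdef R : {pred R})} in
  GRing.isZmodule.Build (RmodZ R)
    (@addrA Q) (@addrC Q) (@add0r Q) (@addNr Q).

(* The Pontryagin dual of Z Gamma / Z Gamma f: the element h stands for the
   character u |-> \sum_g h g^-1 *~ u g of Z Gamma, and the condition says that
   this character vanishes on Z Gamma f. Under this identification the action
   dual to left translation is the right shift. *)
Definition X_set (R : realType) (G : groupType) (f : ZGamma G) :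
    set (G -> RmodZ R) :=
  [set h | forall x : G, \sum_(g <- finsupp f) h (g^-1 * x)%g *~ f g = 0].
Arguments X_set R {G} f.

Definition X_ (R : realType) (G : groupType) (f : ZGamma G) : Type :=
  initial_topology (\val : X_set R f -> {ptws G -> RmodZ R}).
Arguments X_ R {G} f.

HB.instance Definition _ (R : realType) (G : groupType) (f : ZGamma G) :=
  Topological.copy (X_ R f)
    (initial_topology (\val : X_set R f -> {ptws G -> RmodZ R})).

Lemma right_shift_subproof (R : realType) (G : groupType) (f : ZGamma G)
    (g : G) (h : X_set R f) :
  (fun x => \val h (x * g)%g) \in X_set R f.
Proof.
apply/mem_set => x; rewrite -[RHS](set_mem (valP h) (x * g)%g).
by apply: eq_bigr => k _; rewrite mulgA.
Qed.

Definition alpha (R : realType) (G : groupType) (f : ZGamma G) (g : G)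
    (h : X_ R f) : X_ R f :=
  SigSub (right_shift_subproof g h).
Arguments alpha R {G} f g h.

Definition abs2 (R : realType) (z : R[i]) : R :=
  complex.Re z ^+ 2 + complex.Im z ^+ 2.

Definition l2_sum (R : realType) (G : choiceType) (xi : G -> R[i]^o) : \bar R :=
  \esum_(g in [set: G]) (abs2 (xi g))%:E.

Definition l2_pred (R : realType) (G : choiceType) : {pred G -> R[i]^o} :=
  fun xi => `[< (l2_sum xi < +oo)%E >].

Lemma abs2_ge0 (R : realType) (z : R[i]) : 0 <= abs2 z.
Proof. by rewrite addr_ge0 ?sqr_ge0. Qed.

Lemma abs2_comb (R : realType) (c z w : R[i]) :
  abs2 (c * z + w) <= (2 * abs2 c) * abs2 z + 2 * abs2 w.
Proof.
case: c z w => [a b] [x y] [u v]; rewrite /abs2 /=.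
rewrite -subr_ge0.
have -> : 2 * (a ^+ 2 + b ^+ 2) * (x ^+ 2 + y ^+ 2) + 2 * (u ^+ 2 + v ^+ 2) -
  ((a * x - b * y + u) ^+ 2 + (a * y + b * x + v) ^+ 2) =
  (a * x - b * y - u) ^+ 2 + (a * y + b * x - v) ^+ 2 by ring.
by rewrite addr_ge0 ?sqr_ge0.
Qed.

Lemma esum_scale_le (R : realType) (T : choiceType) (k : R) (a : T -> R) :
  0 <= k -> (forall t, 0 <= a t) ->
  (\esum_(t in [set: T]) (k * a t)%:E <=
     k%:E * \esum_(t in [set: T]) (a t)%:E)%E.
Proof.
move=> k0 a0; apply: ge_ereal_sup => _ [X [finX XT] <-].
under eq_fsbigr do rewrite EFinM.
rewrite -ge0_mule_fsumr; last by move=> t; rewrite lee_fin.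
apply: lee_wpmul2l; first by rewrite lee_fin.
by apply: ereal_sup_ubound; exists X.
Qed.

Lemma l2_submod_closed (R : realType) (G : choiceType) :
  submod_closed (@l2_pred R G).
Proof.
split=> [|c xi eta].
  apply/asboolP; rewrite /l2_sum esum1 ?ltry// => g _.
  by rewrite /abs2 /= expr0n addr0.
move=> /asboolP xiP /asboolP etaP; apply/asboolP.
have bound k (z : G -> R[i]^o) : 0 <= k -> (l2_sum z < +oo)%E ->
    (\esum_(g in [set: G]) (k * abs2 (z g))%:E < +oo)%E.
  move=> k0 zP.
  apply: le_lt_trans (esum_scale_le k0 (fun g => abs2_ge0 (z g))) _.
  by rewrite lte_mul_pinfty// ?lee_fin.
apply: (@le_lt_trans _ _ (\esum_(g in [set: G])
    ((2 * abs2 c * abs2 (xi g))%:E + (2 * abs2 (eta g))%:E)%E)).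
  by apply: le_esum => g _; rewrite -EFinD lee_fin abs2_comb.
rewrite esumD; [|by move=> g _; rewrite lee_fin !mulr_ge0 ?abs2_ge0..].
by rewrite lte_add_pinfty// bound// ?mulr_ge0 ?abs2_ge0.
Qed.

HB.instance Definition _ (R : realType) (G : choiceType) :=
  GRing.isSubmodClosed.Build R[i] (G -> R[i]^o) (@l2_pred R G)
    (@l2_submod_closed R G).

Record l2 (R : realType) (G : choiceType) := L2 {
  l2_fun :> G -> R[i]^o ;
  l2_funP : l2_fun \in @l2_pred R G }.

HB.instance Definition _ (R : realType) (G : choiceType) :=
  [isSub for @l2_fun R G].
HB.instance Definition _ (R : realType) (G : choiceType) :=
  [Choice of l2 R G by <:].
HB.instance Definition _ (R : realType) (G : choiceType) :=
  [SubChoice_isSubLmodule of l2 R G by <:].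

Definition l2norm (R : realType) (G : choiceType) (xi : l2 R G) : R :=
  Num.sqrt (fine (l2_sum xi)).

Definition bounded_op (R : realType) (G : choiceType)
    (T : l2 R G -> l2 R G) :=
  linear T /\ exists M : R, forall xi, l2norm (T xi) <= M * l2norm xi.

Definition conv (R : realType) (G : groupType) (a : CGamma R G)
    (xi : G -> R[i]^o) : G -> R[i]^o :=
  fun x => \sum_(g <- finsupp a) a g * xi (g^-1 * x)%g.

Lemma conv_l2 (R : realType) (G : groupType) (a : CGamma R G) (xi : l2 R G) :
  conv a xi \in @l2_pred R G.
Proof.
have -> : conv a xi = \sum_(g <- finsupp a)
    (a g *: ((fun x => xi (g^-1 * x)%g) : G -> R[i]^o)).
  by apply/funext => x; rewrite /conv fct_sumE.
apply: rpred_sum => g _; apply: rpredZ; apply/asboolP.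
rewrite /l2_sum -(reindex_esum setT setT (fun x => g^-1 * x)%g
  (fun y => (abs2 (xi y))%:E)); first by have /asboolP := l2_funP xi.
split=> //; first by move=> x y _ _; apply: mulgI.
by move=> y _; exists (g * y)%g => //; rewrite mulKg.
Qed.

Definition lmul (R : realType) (G : groupType) (a : CGamma R G)
  (xi : l2 R G) : l2 R G := L2 (conv_l2 a xi).

(* A basis of strong operator neighbourhoods of T is given by finite lists of
   vectors and e > 0. *)
Definition strong_closure (R : realType) (G : choiceType)
    (A : set (l2 R G -> l2 R G)) : set (l2 R G -> l2 R G) :=
  [set T | forall (s : seq (l2 R G)) (e : R), 0 < e ->
     exists2 S, A S & forall xi, xi \in s -> l2norm (T xi - S xi) < e].

Definition LGamma (R : realType) (G : groupType) : set (l2 R G -> l2 R G) :=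
  [set T | bounded_op T /\ strong_closure (range (@lmul R G)) T].
Arguments LGamma : clear implicits.

Definition invertible_in_LGamma (R : realType) (G : groupType)
    (f : ZGamma G) :=
  exists2 T, LGamma R G T &
    cancel (lmul (complexify R f)) T /\ cancel T (lmul (complexify R f)).
Arguments invertible_in_LGamma R {G} f.

(* Main.v *)
Require Import Defs.
From mathcomp Require Import all_boot all_order all_algebra finmap.
From mathcomp Require Import all_classical all_reals all_analysis.
From mathcomp Require Import perm complex ring lra zify.

(* Write f[A,B] for the matrix with entries f (x y^-1), x in A and y in B, let
   K be the support of f, and let M_f(F) be the largest absolute value of a
   minor of size |F| of f[KF,F].
   Representatives zeta of Z^J / f[J,F] Z^F, for the best choice of J in KF,
   give M_f(F) points f^-1 zeta of X_f. A single cover of X_f by small arcs at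
   one coordinate already separates them up to a factor exp(o(|F|)), because f
   is bounded below on l2. Hence log M_f(F_n) / |F_n| is asymptotically a lower
   bound for the growth rate of this cover.
   Conversely, restrict points of X_f to a set C slightly larger than F and
   push a lift in [0,1]^C along the kernel of f[F,C] to a vertex, all of whose
   coordinates outside some J with |J| = |F| are integral. The number of such
   vertices modulo Z^C is governed by det f[F,J], a minor of the transpose of
   f*[C,F], and the vectors of the kernel that have bounded coordinates form
   few classes up to a small l2-error, again because f is bounded below. Hence
   the growth rate of every cover of X_f is asymptotically bounded by
   log M_f*(F_n) / |F_n|.
   Exchanging f and f* closes the circle. The rates converge because M_f(F)^2
   is comparable with det (f* f)[F,F] by the Cauchy-Binet formula, and the
   logarithm of this Gram determinant is submodular in F. *)

Set Implicit Arguments.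
Unset Strict Implicit.
Unset Printing Implicit Defensive.

Import Order.TTheory GRing.Theory Num.Theory.
Import numFieldNormedType.Exports.

Local Open Scope ring_scope.

(** * Counting and determinants *)

(** The inverse of f is only a bounded operator on l2 and need not be summable, so f^-1 zeta cannot
    be controlled coordinate by coordinate: only sums of squares are bounded. This obstacle shapes
    both counts. Instead of a bounded number of choices at each point there is an integral vector of
    l1-norm O(|F|) on a boundary of size o(|F|), or a set of exceptional points of F of size
    proportional to a boundary. Both are counted by a generating function with a parameter t that is
    fixed before n tends to infinity. In the lower bound t is close to 1: the factor t^O(|F|) is
    then cheap, and a constant to the power o(|F|) remains. In the upper bound t is close to 0: the
    factor (1 + t p)^|F| is then cheap, and a power of 1/t with exponent o(|F|) remains.
    Invertibility enters through two finitary statements on real functions, [solvable] and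
    [bounded_below], which are linked by the duality between f and f*. *)

Lemma weighted_count (R : realFieldType) (I A : finType) (w : A -> nat)
    (L : nat) (t : R) : 0 < t -> t <= 1 ->
  #|[set u : {ffun I -> A} | (\sum_i w (u i) <= L)%N]|%:R * t ^+ L
    <= (\sum_a t ^+ w a) ^+ #|I|.
Proof.
move=> t0 t1.
(* Rankin's trick: the expanded power is the sum of [t ^+ (\sum_i w (u i))] over all [u], and a [u]
   of total weight at most [L] contributes at least [t ^+ L] because [t <= 1]. *)
rewrite -prodr_const bigA_distr_bigA /= -sum1_card natr_sum mulr_suml.
rewrite big_mkcond; apply: ler_sum => u _; rewrite inE; case: ifP => uL.
  rewrite mul1r prodrXr; apply: ler_wiXn2l => //; exact: ltW.
by apply: prodr_ge0 => i _; rewrite exprn_ge0// ltW.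
Qed.

Lemma geometric_le (R : realFieldType) (n : nat) (t : R) : 0 < t -> t < 1 ->
  \sum_(i < n) t ^+ i <= (1 - t)^-1.
Proof.
move=> t0 t1; have t1' : 0 < 1 - t by rewrite subr_gt0.
rewrite -(ler_pM2l t1') divff ?gt_eqF//.
have -> : (1 - t) * \sum_(i < n) t ^+ i = 1 - t ^+ n.
  by rewrite -opprB mulNr -subrX1 opprB.
by rewrite gerBl exprn_ge0// ltW.
Qed.

(** The base [2 / (1 - t)] bounds the two-sided geometric series of [t ^+ |a|] over the integers a.
    The bound is of use when [L] is much larger than the number of coordinates. *)
Lemma integer_vectors_count (R : realFieldType) (I J : finType)
    (v : J -> {ffun I -> int}) (L : nat) (t : R) :
    0 < t -> t < 1 -> injective v ->
    (forall j, \sum_i `|v j i|%N <= L)%N ->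
  #|J|%:R * t ^+ L <= (2 / (1 - t)) ^+ #|I|.
Proof.
move=> t0 t1 vinj vL.
have vle j i : (`|v j i|%N <= L)%N.
  by apply: leq_trans (vL j); rewrite (bigD1 i) //= leq_addr.
(* Entries lie in [-L, L]; the shift by [L] makes them letters of a finite alphabet, weighted by the
   distance to the middle letter [L]. *)
pose w (a : 'I_(L + L).+1) := `|((a : nat)%:Z - L%:Z)%R|%N.
pose u j : {ffun I -> 'I_(L + L).+1} := [ffun i => inord `|(v j i + L%:Z)%R|%N].
have uE j i : (u j i : nat)%:Z = v j i + L%:Z.
  have vji := vle j i; rewrite ffunE inordK; last by lia.
  rewrite gez0_abs//; lia.
have uinj : injective u.
  move=> j j' ujj'; apply: vinj; apply/ffunP => i.
  by apply: (addIr L%:Z); rewrite -!uE ujj'.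
apply: (@le_trans _ _ ((\sum_a t ^+ w a) ^+ #|I|)).
  apply: (le_trans _ (weighted_count I w L t0 (ltW t1))).
  apply: ler_wpM2r; first by rewrite exprn_ge0// ltW.
  rewrite ler_nat -cardsT -(card_imset _ uinj).
  apply/subset_leq_card/fintype.subsetP => _ /imsetP[j _ ->]; rewrite inE.
  apply: leq_trans (vL j); apply: leq_sum => i _.
  by rewrite /w uE addrK.
have -> : 2 / (1 - t) = (1 - t)^-1 + (1 - t)^-1 by rewrite mulrDl mul1r.
apply: lerXn2r; rewrite ?nnegrE ?addr_ge0 ?invr_ge0 ?subr_ge0 ?(ltW t1)//.
  by apply: sumr_ge0 => a _; rewrite exprn_ge0// ltW.
(* The letters up to [L], read backwards, and the letters after [L] each give a sum bounded by a
   partial geometric series. *)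
rewrite -[(L + L).+1]/(L.+1 + L)%N big_split_ord /= lerD//.
  apply: (le_trans _ (geometric_le L.+1 t0 t1)).
  rewrite (reindex_inj rev_ord_inj) /=; apply: ler_sum => i _.
  by apply: ler_wiXn2l; rewrite ?ltW// /w /=; have := ltn_ord i; lia.
apply: (le_trans _ (geometric_le L t0 t1)).
by apply: ler_sum => i _; apply: ler_wiXn2l; rewrite ?ltW// /w /=; lia.
Qed.

Lemma binomial_count (R : realFieldType) (n m : nat) (t : R) : 0 <= t ->
  'C(n, m)%:R * t ^+ m <= (1 + t) ^+ n.
Proof.
move=> t0; have [mn|nm] := leqP m n; last first.
  by rewrite bin_small// mul0r exprn_ge0// addr_ge0.
rewrite exprDn (bigD1 (inord m)) //= inordK ?ltnS// expr1n mul1r mulr_natl.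
by rewrite lerDl sumr_ge0// => i _; rewrite expr1n mul1r mulrn_wge0 ?exprn_ge0.
Qed.

Lemma det_gram (R : comNzRingType) n k (B : 'M[R]_(n, k)) :
  \det (B^T *m B) =
  \sum_(r : {ffun 'I_k -> 'I_n}) (\prod_i B (r i) i) * \det (rowsub r B).
Proof.
rewrite /determinant.
under eq_bigr => s _.
  under eq_bigr => i _ do rewrite mxE.
  rewrite bigA_distr_bigA /= mulr_sumr; over.
rewrite exchange_big /=; apply: eq_bigr => r _; rewrite mulr_sumr.
apply: eq_bigr => s _; rewrite mulrCA -big_split; congr (_ * _).
by apply: eq_bigr => i _; rewrite !mxE.
Qed.

(* Summing over all row selections counts every k-subset of the rows k! times
   and gives the Cauchy-Binet formula. *)
Lemma cauchy_binet_fact (R : comNzRingType) n k (B : 'M[R]_(n, k)) :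
  k`!%:R * \det (B^T *m B) =
  \sum_(r : {ffun 'I_k -> 'I_n}) \det (rowsub r B) ^+ 2.
Proof.
under eq_bigr => r _ do rewrite expr2 {1}/determinant mulr_suml.
rewrite exchange_big /= -card_Sn -sum1_card natr_sum mulr_suml.
apply: eq_big => [s|s _]; first by []; rewrite mul1r det_gram.
pose h (r : {ffun 'I_k -> 'I_n}) : {ffun 'I_k -> 'I_n} := [ffun i => r (s i)].
have hK : bijective h.
  exists (fun r : {ffun 'I_k -> 'I_n} => [ffun i => r ((s^-1)%g i)]) => r;
  by apply/ffunP => i; rewrite !ffunE ?permK ?permKV.
rewrite [RHS](reindex h) /=; last exact: onW_bij.
apply: eq_bigr => r _.
have hrE : rowsub (h r) B = row_perm s (rowsub r B).
  by apply/matrixP => i j; rewrite !mxE ffunE.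
have -> : \det (rowsub (h r) B) = (-1) ^+ s * \det (rowsub r B).
  by rewrite hrE row_permE det_mulmx det_perm.
rewrite mulrACA -signr_addb addbb expr0 mul1r; congr (_ * _).
rewrite (reindex_inj (@perm_inj _ s)); apply: eq_bigr => i _.
by rewrite !mxE ffunE.
Qed.

(** The Smith normal form A = L D U reduces the class of z modulo A Z^k to the residues of L^-1 z
    modulo the diagonal entries of D, whose product is the determinant up to sign. *)
Lemma coker_classes k (A : 'M[int]_k) : \det A != 0 ->
  exists (T : finType) (c : 'cV[int]_k -> T),
    [/\ #|T| = `|\det A|%N,
        forall z z', c z = c z' <-> exists w, z - z' = A *m w &
        forall t, exists z, c z = t].
Proof.
move=> A0; have [L Lu [U Uu [d _ AE]]] := int_Smith_normal_form A.
pose e (i : 'I_k) := d`_i.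
set D := \matrix_(i, j) _ in AE.
have DE : D = diag_mx (\row_i e i).
  by apply/matrixP => i j; rewrite !mxE.
have unit1 (B : 'M[int]_k) : B \in unitmx -> `|\det B|%N = 1%N.
  by rewrite unitmxE => /orP[] /eqP ->.
have detE : `|\det A|%N = (\prod_(i < k) absz (e i))%N.
  rewrite AE !det_mulmx !abszM (unit1 L)// (unit1 U)// mul1n muln1 DE det_diag.
  rewrite (big_morph absz abszM (erefl _)).
  by apply: eq_bigr => i _; rewrite mxE.
have d0 (i : 'I_k) : e i != 0.
  apply: contraNneq A0 => di; rewrite -absz_eq0 detE (bigD1 i)//=.
  by rewrite di mul0n.
(* The shape [.-1.+1] makes each residue type visibly inhabited, as [inord] requires; it changes
   nothing since [e i] is nonzero. *)
pose T := {dffun forall i : 'I_k, 'I_((absz (e i)).-1.+1)}.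
pose y (z : 'cV[int]_k) i := (invmx L *m z) i 0.
pose c (z : 'cV[int]_k) : T := [ffun i : 'I_k => inord `|(y z i %% e i)%Z|%N].
have modlt (i : 'I_k) (z : int) : (`|(z %% e i)%Z| < (absz (e i)).-1.+1)%N.
  by rewrite prednK ?absz_gt0// -ltz_nat gez0_abs ?modz_ge0// ltz_mod.
have cE z i : (c z i : nat)%:Z = (y z i %% e i)%Z.
  by rewrite ffunE inordK ?modlt// gez0_abs ?modz_ge0.
have yB z z' i : y (z - z') i = y z i - y z' i.
  by rewrite /y mulmxBr !mxE.
have yA w i : y (A *m w) i = e i * (U *m w) i 0.
  by rewrite /y AE -!mulmxA mulKmx// DE mul_diag_mx !mxE.
exists T, c; split.
- rewrite detE card_dep_ffun foldrE big_map big_enum /=.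
  by apply: eq_bigr => i _; rewrite card_ord prednK// absz_gt0.
- move=> z z'; split=> [czz'|[w zw]].
    have dvd i : (e i %| y (z - z') i)%Z.
      rewrite yB -eqz_mod_dvd.
      by have := congr1 (fun t : T => (t i : nat)%:Z) czz'; rewrite !cE => ->.
    exists (invmx U *m \col_i (y (z - z') i %/ e i)%Z).
    rewrite AE -!mulmxA mulKVmx// DE.
    rewrite -[LHS](mulKVmx Lu); congr (_ *m _); apply/colP => i.
    by rewrite mul_diag_mx !mxE mulrC divzK// ?dvd// /y mxE.
  apply/ffunP => i; apply/val_inj; apply/eqP; rewrite -eqz_nat !cE.
  by rewrite eqz_mod_dvd -yB zw yA dvdz_mulr.
- move=> t; exists (L *m \col_i (t i : nat)%:Z).
  apply/ffunP => i; apply/val_inj; apply/eqP; rewrite -eqz_nat cE.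
  rewrite /y mulKmx// mxE -modz_abs modz_small//= ltz_nat.
  by have := ltn_ord (t i); rewrite [X in (_ < X)%N]prednK ?absz_gt0.
Qed.

(** * Vertices of affine slices of the unit cube *)

Lemma move_to_face (R : realFieldType) n (v u : 'cV[R]_n) (j : 'I_n) :
    (forall l, 0 <= v l 0 <= 1) -> u j 0 != 0 ->
  exists t l, [/\ u l 0 != 0, (forall l, 0 <= (v + t *: u) l 0 <= 1) &
    (v + t *: u) l 0 = 0 \/ (v + t *: u) l 0 = 1].
Proof.
move=> v01 uj.
(* Ratio test: [lim l] is the time at which coordinate [l] leaves [0,1] along [u]. Stopping at the
   earliest such time keeps all coordinates inside and puts one of them on a wall. *)
pose lim l := if 0 < u l 0 then (1 - v l 0) / u l 0 else v l 0 / - u l 0.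
have [l ul lmin] := @arg_minP _ R _ j (fun l => u l 0 != 0) lim uj.
exists (lim l), l; split=> //.
- move=> i; rewrite !mxE; have /andP[vi0 vi1] := v01 i.
  have liml0 : 0 <= lim l.
    rewrite /lim; have /andP[vl0 vl1] := v01 l; case: ifPn => ul0.
      by rewrite divr_ge0 ?subr_ge0// ltW.
    by rewrite divr_ge0// oppr_ge0 leNgt.
  have [ui|ui|->] := ltgtP (u i 0) 0; last by rewrite mulr0 addr0 vi0.
    have := lmin i; rewrite lt_eqF// => /(_ isT).
    rewrite {2}/lim ltNge (ltW ui) /= ler_pdivlMr ?oppr_gt0// => h.
    rewrite -subr_ge0 in h; apply/andP; split; first by lra.
    have : lim l * u i 0 <= 0 by rewrite mulr_ge0_le0// ltW.
    by lra.
  have := lmin i; rewrite gt_eqF// => /(_ isT).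
  rewrite {2}/lim ui ler_pdivlMr// => h.
  have : 0 <= lim l * u i 0 by rewrite mulr_ge0// ltW.
  by lra.
- rewrite !mxE /lim; case: ifPn => ul0.
    by right; rewrite divfK// addrC subrK.
  by left; rewrite invrN mulrN mulNr divfK// subrr.
Qed.

(** A pivot of the simplex method. The kernel vector [u] has entry 1 at [j] and is otherwise
    supported on the basic columns, so the other nonbasic coordinates stay put. If the coordinate
    that reaches a wall is a basic one, [r i], it is exchanged for [j]; being moved by [u], it has a
    nonzero coefficient in the expansion of column [j], so the columns remain a basis. *)
Lemma basic_solution_step (R : realFieldType) k n (A : 'M[R]_(k, n))
    (v : 'cV[R]_n) (r : {ffun 'I_k -> 'I_n}) (j : 'I_n) :
    (forall l, 0 <= v l 0 <= 1) -> \det (colsub r A) != 0 ->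
    j \notin codom r ->
  exists v' : 'cV[R]_n, exists r' : {ffun 'I_k -> 'I_n},
    [/\ A *m v' = A *m v, (forall l, 0 <= v' l 0 <= 1),
        \det (colsub r' A) != 0 &
        forall l, l \notin codom r' ->
          (l != j) && (l \notin codom r) && (v' l 0 == v l 0) ||
          (v' l 0 \in [:: 0; 1])].
Proof.
move=> v01 rA jr; set Ar := colsub r A in rA *.
have Aru : Ar \in unitmx by rewrite unitmxE unitfE.
pose w := invmx Ar *m col j A.
have ArwE : Ar *m w = col j A by rewrite /w mulKVmx.
pose u : 'cV[R]_n := \col_l ((l == j)%:R - \sum_i w i 0 * (l == r i)%:R).
have Au : A *m u = 0.
  have -> : u = delta_mx j 0 - \sum_i w i 0 *: delta_mx (r i) 0.
    apply/colP => l; rewrite !mxE summxE eqxx andbT; congr (_ - _).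
    by apply: eq_bigr => i _; rewrite !mxE eqxx andbT.
  rewrite mulmxBr mulmx_sumr -colE -ArwE; apply/eqP; rewrite subr_eq0.
  apply/eqP/colP => i; rewrite !mxE summxE; apply: eq_bigr => l _.
  by rewrite -scalemxAr -colE !mxE mulrC.
have uj : u j 0 != 0.
  rewrite mxE eqxx big1 ?subr0 ?oner_eq0// => i _.
  case: eqP => [ji|]; last by rewrite mulr0.
  by case/negP: jr; rewrite ji codom_f.
have uout l : l != j -> l \notin codom r -> u l 0 = 0.
  move=> lj lr; rewrite mxE (negbTE lj) big1 ?subr0// => i _.
  case: eqP => [li|]; last by rewrite mulr0.
  by case/negP: lr; rewrite li codom_f.
have [t [l [ul v'01 v'l]]] := move_to_face v01 uj.
set v' := v + t *: u in v'01 v'l.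
have Av' : A *m v' = A *m v by rewrite mulmxDr -scalemxAr Au scaler0 addr0.
have v'lP : v' l 0 \in [:: 0; 1].
  by rewrite !inE; case: v'l => ->; rewrite eqxx ?orbT.
have v'E i : i != j -> i \notin codom r -> v' i 0 = v i 0.
  by move=> ij ir; rewrite 2!mxE uout// mulr0 addr0.
have [lj|lj] := eqVneq l j.
  exists v', r; split=> // i ir; have [ij|ij] := eqVneq i j.
    by rewrite ij -lj v'lP.
  by rewrite ir v'E// eqxx.
have [i /eqP ril wi] : exists2 i, r i == l & w i 0 != 0.
  apply/exists_inP; apply: contraNT ul => /exists_inPn h.
  rewrite mxE (negbTE lj) big1 ?subr0// => i _; case: eqP => [li|]; last first.
    by rewrite mulr0.
  have /h : r i == l by rewrite -li. rewrite negbK => /eqP ->.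
  by rewrite mul0r.
pose r' : {ffun 'I_k -> 'I_n} := [ffun i' => if i' == i then j else r i'].
exists v', r'; split=> //.
  (* A row vector killing the new minor kills all old basic columns but the [i]-th, and also column
     [j], where the [i]-th one occurs with coefficient [w i 0], not 0; hence it kills the old
     minor. *)
  apply/negP => /det0P[y y0 yr'].
  have yr i' : i' != i -> (y *m Ar) 0 i' = 0.
    move=> ii'; have <- : (y *m colsub r' A) 0 i' = 0 by rewrite yr' mxE.
    by rewrite !mxE; apply: eq_bigr => m _; rewrite !mxE ffunE (negbTE ii').
  have yj : (y *m col j A) 0 0 = 0.
    have <- : (y *m colsub r' A) 0 i = 0 by rewrite yr' mxE.
    by rewrite !mxE; apply: eq_bigr => m _; rewrite !mxE ffunE eqxx.
  move: yj; rewrite -ArwE mulmxA mxE (bigD1 i)//= big1 ?addr0; last first.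
    by move=> m mi; rewrite yr// mul0r.
  move/eqP; rewrite mulf_eq0 (negbTE wi) orbF => /eqP yi.
  case/negP: y0; rewrite -[y](mulmxK Aru) (_ : y *m Ar = 0) ?mul0mx//.
  by apply/rowP => m; rewrite [RHS]mxE; have [->|/yr] := eqVneq m i.
move=> m mr'; have [mj|mj] := eqVneq m j.
  by case/negP: mr'; rewrite mj; apply/codomP; exists i; rewrite ffunE eqxx.
have [mr|mr] := boolP (m \in codom r); last by rewrite v'E// eqxx.
case/codomP: mr => i' mi'; have [ii'|ii'] := eqVneq i' i.
  by rewrite mi' ii' ril v'lP orbT.
by case/negP: mr'; apply/codomP; exists i'; rewrite ffunE (negbTE ii').
Qed.

Lemma basic_solution (R : realFieldType) k n (A : 'M[R]_(k, n))
    (x : 'cV[R]_n) : row_free A -> (forall l, 0 <= x l 0 <= 1) ->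
  exists v : 'cV[R]_n, exists r : {ffun 'I_k -> 'I_n},
    [/\ A *m v = A *m x, (forall l, 0 <= v l 0 <= 1),
        \det (colsub r A) != 0 &
        forall l, l \notin codom r -> v l 0 \in [:: 0; 1]].
Proof.
move=> Afree x01.
(* Induction on the number of nonbasic coordinates that are still fractional: a pivot at such a [j]
   creates no new one and removes [j]. *)
pose bad (v : 'cV[R]_n) (r : {ffun 'I_k -> 'I_n}) :=
  [set l | (l \notin codom r) && (v l 0 \notin [:: 0; 1])].
suff H m (v : 'cV[R]_n) (r : {ffun 'I_k -> 'I_n}) :
    (#|bad v r| <= m)%N -> (forall l, 0 <= v l 0 <= 1) ->
    \det (colsub r A) != 0 -> A *m v = A *m x ->
    exists v : 'cV[R]_n, exists r : {ffun 'I_k -> 'I_n},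
    [/\ A *m v = A *m x, (forall l, 0 <= v l 0 <= 1),
        \det (colsub r A) != 0 &
        forall l, l \notin codom r -> v l 0 \in [:: 0; 1]].
  have Afull : row_full A^T.
    by rewrite /row_full mxrank_tr; exact: Afree.
  pose r := fullrankfun Afull.
  apply: (H _ x r (leqnn _)) => //.
  have := fullrowsub_unit Afull; rewrite unitmxE unitfE -det_tr.
  by rewrite (_ : _^T = colsub r A)//; apply/matrixP => i l; rewrite !mxE.
elim: m v r => [|m IH] v r bm v01 rA Av.
  move: bm; rewrite leqn0 cards_eq0 => /eqP b0.
  exists v, r; split=> // l lr; apply/negPn/negP => vl.
  have : l \in bad v r by rewrite inE lr vl.
  by rewrite b0 inE.
have [b0|[j]] := set_0Vmem (bad v r).
  by apply: (IH v r) => //; rewrite b0 cards0.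
rewrite inE => /andP[jr vj].
have [v' [r' [Av' v'01 r'A h]]] := basic_solution_step v01 rA jr.
apply: (IH v' r') => //; last by rewrite Av'.
rewrite -ltnS; apply: leq_trans bm; apply: proper_card; apply/properP; split.
  apply/fintype.subsetP => l; rewrite !inE => /andP[lr' v'l].
  have := h l lr'; rewrite !inE in v'l *; rewrite (negbTE v'l) orbF.
  by move=> /andP[/andP[_ ->] /eqP <-].
exists j; first by rewrite inE jr vj.
rewrite inE; apply/negP => /andP[jr' v'j]; have := h j jr'.
by rewrite eqxx (negbTE v'j).
Qed.

(** * Gram determinants *)

Definition gram (R : nzRingType) (T : Type) (a : T -> T -> R) (s : seq T) :
    'M[R]_(size s) :=
  \matrix_(i, j) a (tnth (in_tuple s) i) (tnth (in_tuple s) j).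

Definition quad (R : nzRingType) (T : Type) (a : T -> T -> R) (s : seq T)
    (y : T -> R) : R :=
  \sum_(u <- s) \sum_(v <- s) y u * y v * a u v.

Definition pos_def (R : numDomainType) (T : eqType) (a : T -> T -> R) :=
  (forall u v, a u v = a v u) /\
  forall (s : seq T) (y : T -> R), uniq s -> has (fun u => y u != 0) s ->
    0 < quad a s y.

Lemma eq_quad (R : nzRingType) (T : eqType) (a : T -> T -> R) (s : seq T)
    (y z : T -> R) : {in s, y =1 z} -> quad a s y = quad a s z.
Proof.
move=> yz; apply: eq_big_seq => u us; apply: eq_big_seq => v vs.
by rewrite !yz.
Qed.

Lemma quad_filter (R : nzRingType) (T : eqType) (a : T -> T -> R)
    (P : pred T) (s : seq T) (y : T -> R) :
  quad a (seq.filter P s) y = quad a s (fun u => if P u then y u else 0).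
Proof.
rewrite /quad big_filter big_mkcond; apply: eq_bigr => u _.
case: ifP => Pu; last first.
  by rewrite big1// => v _; rewrite !mul0r.
rewrite big_filter big_mkcond; apply: eq_bigr => v _.
by case: ifP => // _; rewrite mulr0 mul0r.
Qed.

Lemma quad_ge0 (R : numDomainType) (T : eqType) (a : T -> T -> R)
    (s : seq T) (y : T -> R) : pos_def a -> uniq s -> 0 <= quad a s y.
Proof.
move=> [_ apos] us; have [/(apos _ _ us)/ltW//|] := boolP (has (fun u => y u != 0) s).
rewrite -all_predC => /allP y0; rewrite /quad big_seq big1// => u us'.
rewrite big1// => v _; have := y0 u us'; rewrite /= negbK => /eqP ->.
by rewrite !mul0r.
Qed.

Lemma quadE (R : comNzRingType) (T : eqType) (a : T -> T -> R) (s : seq T)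
    (y : T -> R) (e : 'cV[R]_(size s)) :
  (forall i, e i 0 = y (tnth (in_tuple s) i)) ->
  quad a s y = (e^T *m gram a s *m e) 0 0.
Proof.
move=> eE; rewrite /quad (big_tnth _ _ s) mxE.
under [RHS]eq_bigr do rewrite mxE mulr_suml.
rewrite [RHS]exchange_big /=; apply: eq_bigr => i _.
rewrite (big_tnth _ _ s); apply: eq_bigr => j _.
by rewrite !mxE !eE mulrAC.
Qed.

Lemma vec_fun (R : nzRingType) (T : eqType) (s : seq T)
    (e : 'cV[R]_(size s)) : uniq s ->
  exists y : T -> R, forall i, e i 0 = y (tnth (in_tuple s) i).
Proof.
move=> us.
exists (fun u => \sum_(i < size s) (if tnth (in_tuple s) i == u then e i 0 else 0)).
move=> i; rewrite (bigD1 i)//= eqxx big1 ?addr0// => j ji.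
have /tuple_uniqP tinj : uniq (in_tuple s) by [].
by case: eqP => // /tinj ij; case/eqP: ji.
Qed.

Lemma gram_det_neq0 (R : numFieldType) (T : eqType) (a : T -> T -> R)
    (s : seq T) : pos_def a -> uniq s -> \det (gram a s) != 0.
Proof.
move=> [asym apos] us; apply/negP => /det0P[e e0 eg].
have [y yE] := vec_fun e^T us.
have : ~~ has (fun u => y u != 0) s.
  by apply/negP => /(apos s y us); rewrite (quadE _ yE) trmxK eg mul0mx mxE ltxx.
rewrite -all_predC => /allP y0; case/negP: e0; apply/eqP/rowP => i.
have := yE i; rewrite !mxE => ->; apply/eqP; rewrite -[_ == _]negbK.
exact: y0 (mem_tnth _ (in_tuple s)).
Qed.

Lemma schur_complement (R : comUnitRingType) n (a : 'M[R]_1)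
    (b : 'rV[R]_n) (c : 'cV[R]_n) (M : 'M[R]_n) : M \in unitmx ->
  \det (block_mx a b c M) = (a - b *m invmx M *m c) 0 0 * \det M.
Proof.
move=> Mu.
have E : block_mx a b c M *m block_mx 1%:M 0 (- (invmx M *m c)) 1%:M =
    block_mx (a - b *m invmx M *m c) b 0 M.
  rewrite mulmx_block !mulmx1 !mulmx0 !add0r !mulmxN !mulmxA.
  by rewrite mulmxV// mul1mx subrr.
have := congr1 determinant E.
by rewrite det_mulmx det_lblock !det1 !mulr1 det_ublock det_mx11.
Qed.

Lemma quad_cons (R : comNzRingType) (T : eqType) (a : T -> T -> R) (x : T)
    (s : seq T) (y : T -> R) : (forall u v, a u v = a v u) -> y x = 1 ->
  quad a (x :: s) y =
    a x x + 2 * \sum_(u <- s) y u * a x u + quad a s y.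
Proof.
move=> asym yx; rewrite /quad !big_cons !yx !mul1r.
under [X in _ + X]eq_bigr do rewrite big_cons yx mulr1.
rewrite big_split /= addrA; congr (_ + _).
rewrite -addrA mulr2n mulrDl mul1r; congr (_ + (_ + _)).
  by apply: eq_bigr => v _; rewrite mul1r.
by apply: eq_bigr => v _; rewrite asym.
Qed.

(* The quotient of consecutive Gram determinants is the squared distance from
   the new vector to the span of the old ones. *)
Lemma gram_ratio (R : numFieldType) (T : eqType) (a : T -> T -> R) (x : T)
    (s : seq T) : pos_def a -> uniq s ->
  exists q, [/\ \det (gram a (x :: s)) = q * \det (gram a s),
    (forall y, y x = 1 -> q <= quad a (x :: s) y) &
    (x \notin s -> exists2 y, y x = 1 & quad a (x :: s) y = q)].
Proof.
move=> ap us; have [asym apos] := ap; pose M := gram a s.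
have Mu : M \in unitmx by rewrite unitmxE unitfE; exact: gram_det_neq0.
pose b : 'rV[R]_(size s) := \row_j a x (tnth (in_tuple s) j).
pose g : 'M[R]_(1 + size s) := gram a (x :: s).
have gramE : g = block_mx (a x x)%:M b b^T M.
  have <- : ulsubmx g = (a x x)%:M.
    by apply/matrixP => i j; rewrite !ord1 !mxE !(tnth_nth x).
  have <- : ursubmx g = b.
    by apply/matrixP => i j; rewrite !ord1 !mxE !(tnth_nth x).
  have <- : dlsubmx g = (ursubmx g)^T.
    by apply/matrixP => i j; rewrite !ord1 !mxE asym.
  have <- : drsubmx g = M.
    by apply/matrixP => i j; rewrite !mxE !(tnth_nth x).
  by rewrite submxK.
have Msym : M^T = M by apply/matrixP => i j; rewrite !mxE asym.
exists (((a x x)%:M - b *m invmx M *m b^T) 0 0).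
set q := _ 0 0.
have key y (e : 'cV[R]_(size s)) : y x = 1 -> (forall i, e i 0 = y (tnth (in_tuple s) i)) ->
    quad a (x :: s) y = q +
      ((e + invmx M *m b^T)^T *m M *m (e + invmx M *m b^T)) 0 0.
  move=> yx ey; rewrite quad_cons// (quadE _ ey).
  have -> : \sum_(u <- s) y u * a x u = (b *m e) 0 0.
    rewrite (big_tnth _ _ s) mxE; apply: eq_bigr => i _.
    by rewrite !mxE ey mulrC.
  have bet : (e^T *m b^T) = b *m e.
    by rewrite -trmx_mul; apply/matrixP => i j; rewrite !ord1 mxE.
  have -> : (e + invmx M *m b^T)^T *m M *m (e + invmx M *m b^T) =
      e^T *m M *m e + b *m e + b *m e + b *m invmx M *m b^T.
    have -> : (e + invmx M *m b^T)^T = e^T + b *m invmx M.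
      by rewrite raddfD /= trmx_mul trmxK trmx_inv Msym.
    rewrite mulmxDl.
    rewrite -(mulmxA b) mulVmx// mulmx1 mulmxDl !mulmxDr.
    have -> : e^T *m M *m (invmx M *m b^T) = b *m e.
      by rewrite mulmxA -(mulmxA e^T) mulmxV// mulmx1 bet.
    by rewrite !mulmxA !addrA.
  rewrite /q; move: (e^T *m M *m e) (b *m e) (b *m invmx M *m b^T) => X Y Z.
  by rewrite !mxE eqxx mulr1n; ring.
split.
- by rewrite -schur_complement// -gramE.
- move=> y yx; pose e : 'cV[R]_(size s) := \col_i y (tnth (in_tuple s) i).
  rewrite (key _ e)//; last by move=> i; rewrite mxE.
  rewrite lerDl; have [z zE] := vec_fun (e + invmx M *m b^T) us.
  by rewrite -(quadE _ zE) quad_ge0.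
- move=> xs; have [z zE] := vec_fun (- (invmx M *m b^T)) us.
  pose y u := if u == x then 1 else z u.
  exists y; first by rewrite /y eqxx.
  rewrite (key _ (- (invmx M *m b^T))).
  - by rewrite addNr mulmx0 mxE addr0.
  - by rewrite /y eqxx.
  - move=> i; rewrite zE /y; case: eqP => // ix.
    by case/negP: xs; rewrite -ix; exact: (mem_tnth i (in_tuple s)).
Qed.

Lemma gram_det_gt0 (R : numFieldType) (T : eqType) (a : T -> T -> R)
    (s : seq T) : pos_def a -> uniq s -> 0 < \det (gram a s).
Proof.
move=> ap; elim: s => [|x s IH]; first by rewrite det_mx00.
move=> /[dup] uxs /= /andP[xs us].
have [q [-> _ /(_ xs) [y yx yq]]] := gram_ratio x ap us.
rewrite mulr_gt0 ?IH// -yq; apply: (proj2 ap) => //=.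
by rewrite yx oner_eq0.
Qed.

(** Both quotients are squared distances of [x] to spans, and the span of the filtered family is the
    smaller one: its minimiser, extended by 0, competes in the larger family. This is submodularity
    of the logarithm of Gram determinants, in the form of decreasing increments. *)
Lemma gram_det_cons_le (R : numFieldType) (T : eqType) (a : T -> T -> R)
    (P : pred T) (x : T) (s : seq T) : pos_def a -> uniq (x :: s) -> P x ->
  \det (gram a (x :: s)) / \det (gram a s) <=
  \det (gram a (seq.filter P (x :: s))) / \det (gram a (seq.filter P s)).
Proof.
move=> ap /= /andP[xs us] Px.
have [q [qE qle _]] := gram_ratio x ap us.
have ufs : uniq (seq.filter P s) by rewrite filter_uniq.
have [q' [qE' _]] := gram_ratio x ap ufs.
rewrite mem_filter Px /= => /(_ xs)[y yx yq'].
rewrite qE qE' !mulfK ?gram_det_neq0//.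
have fE : x :: seq.filter P s = seq.filter P (x :: s) by rewrite /= Px.
by rewrite -yq' fE quad_filter; apply: qle; rewrite Px.
Qed.

Lemma gram_det_perm (R : comNzRingType) (T : eqType) (a : T -> T -> R)
    (s s' : seq T) : perm_eq s s' -> \det (gram a s) = \det (gram a s').
Proof.
move=> ss'; have [p ->] := elimT (@tuple_permP _ _ _ (in_tuple s')) ss'.
set t := [tuple _ | _ < _].
have gE (n : nat) (u : n.-tuple T) :
    \det (gram a u) = \det (\matrix_(i < n, j < n) a (tnth u i) (tnth u j)).
  case: u => u un; move: (un); move/eqP: (un) => E; subst n => un'.
  congr (\det _); apply/matrixP => i j; rewrite !mxE.
  by have x0 := tnth (in_tuple u) i; rewrite !(tnth_nth x0).
rewrite gE.
rewrite (_ : \matrix_(i, j) _ = row_perm p (col_perm p (gram a s'))); last first.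
  by apply/matrixP => i j; rewrite !mxE !tnth_mktuple.
rewrite row_permE col_permE !det_mulmx !det_perm odd_permV.
by rewrite mulrCA -signr_addb addbb mulr1.
Qed.

(** * Convolution operators *)

Definition zconv (R : nzRingType) (G : groupType) (f : ZGamma G) (y : G -> R)
    (x : G) : R :=
  \sum_(g <- finsupp f) (f g)%:~R * y (g^-1 * x)%g.

Definition sqsum (R : nzRingType) (T : Type) (s : seq T) (y : T -> R) : R :=
  \sum_(u <- s) y u ^+ 2.

Definition zrow (R : nzRingType) (G : groupType) (f : ZGamma G) (x u : G) : R :=
  (f (x * u^-1)%g)%:~R.

Lemma sqsum_ge0 (R : realDomainType) (T : Type) (s : seq T) (y : T -> R) :
  0 <= sqsum s y.
Proof. by apply: sumr_ge0 => u _; rewrite sqr_ge0. Qed.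

Lemma sum_delta (R : pzRingType) (T : eqType) (s : seq T) (v : T) (F : T -> R) :
  uniq s -> \sum_(u <- s) (u == v)%:R * F u = if v \in s then F v else 0.
Proof.
move=> us; case: ifP => vs.
  rewrite (bigD1_seq v)//= eqxx mul1r big1 ?addr0// => u /negbTE ->.
  by rewrite mul0r.
rewrite big_seq big1// => u; case: eqP => [-> | _]; first by rewrite vs.
by rewrite mul0r.
Qed.

Lemma zrowE (R : nzRingType) (G : groupType) (f : ZGamma G) (x u : G) :
  zrow R f x u = \sum_(g <- finsupp f) (g == x * u^-1)%g%:R * (f g)%:~R.
Proof.
rewrite sum_delta ?fset_uniq// /zrow; case: finsuppP => //.
Qed.

Lemma zconvE (R : nzRingType) (G : groupType) (f : ZGamma G) (y : G -> R)
    (S : seq G) (x : G) : uniq S ->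
  (forall g, g \in finsupp f -> (g^-1 * x)%g \notin S -> y (g^-1 * x)%g = 0) ->
  zconv f y x = \sum_(u <- S) zrow R f x u * y u.
Proof.
move=> uS yS; under [RHS]eq_bigr do rewrite zrowE mulr_suml.
rewrite exchange_big /= /zconv; apply: eq_big_seq => g gf.
transitivity (\sum_(u <- S) (u == g^-1 * x)%g%:R * ((f g)%:~R * y u)).
  rewrite (sum_delta _ (fun u => (f g)%:~R * y u))//.
  by case: ifPn => // /(yS g gf) ->; rewrite mulr0.
apply: eq_bigr => u _; rewrite -mulrA; congr (_%:R * _); congr nat_of_bool.
apply/eqP/eqP => [->|->]; first by rewrite invgM invgK mulVKg.
by rewrite invgM invgK mulgVK.
Qed.

Lemma zrow_star (R : nzRingType) (G : groupType) (f : ZGamma G) (x u : G) :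
  zrow R (star f) x u = zrow R f u x.
Proof. by rewrite /zrow starE invgM invgK. Qed.

Lemma star_star (G : groupType) (f : ZGamma G) : star (star f) = f.
Proof. by apply/fsfunP => g; rewrite !starE invgK. Qed.

Lemma finsupp_star (G : groupType) (f : ZGamma G) (g : G) :
  (g \in finsupp (star f)) = (g^-1%g \in finsupp f).
Proof. by rewrite !mem_finsupp starE. Qed.

(** A finitary form of surjectivity on l2 with a bounded right inverse: the right-hand sides have
    finite support, and the bound on all finite sums of squares of [D] replaces its l2-norm. *)
Definition solvable (R : numDomainType) (G : groupType) (f : ZGamma G) :=
  exists2 C : R, 0 < C & forall (s : seq G) (z : G -> R), uniq s ->
    (forall u, u \notin s -> z u = 0) ->
    exists2 D : G -> R, zconv f D =1 z &
      forall S, uniq S -> sqsum S D <= C * sqsum s z.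

(** The set [N] contains the support of [zconv f y], so that [sqsum N] is the full squared
    l2-norm. *)
Definition bounded_below (R : numDomainType) (G : groupType) (f : ZGamma G) :=
  exists2 C : R, 0 < C & forall (s N : seq G) (y : G -> R), uniq s -> uniq N ->
    (forall u, u \notin s -> y u = 0) ->
    (forall g u, g \in finsupp f -> u \in s -> (g * u)%g \in N) ->
    sqsum s y <= C * sqsum N (zconv f y).

(** Duality: if f D = y then the squared norm of y is the scalar product of D with f* y, and D is
    bounded in terms of y. *)
Lemma solvable_bounded_below (R : realFieldType) (G : groupType)
  (f : ZGamma G) : solvable R f -> bounded_below R (star f).
Proof.
move=> [C C0 solv]; exists C => // s N y us uN ys sN.
have [D Dy DC] := solv s y us ys.
have E : sqsum s y = \sum_(w <- N) zconv (star f) y w * D w.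
  transitivity (\sum_(u <- s) y u * zconv f D u).
    by apply: eq_bigr => u _; rewrite Dy expr2.
  transitivity (\sum_(u <- s) \sum_(w <- N) y u * (zrow R f u w * D w)).
    apply: eq_big_seq => u us'; rewrite -mulr_sumr (zconvE (S := N))// => g gf.
    move=> /negP[]; apply: (sN (g^-1)%g u) => //.
    by rewrite finsupp_star invgK.
  rewrite exchange_big /=; apply: eq_bigr => w _.
  rewrite (zconvE (S := s))//; last by move=> g _; apply: ys.
  rewrite mulr_suml; apply: eq_bigr => u _.
  by rewrite zrow_star mulrA (mulrC (y u)).
(* The arithmetic-geometric inequality with weights [C] and [C^-1] replaces Cauchy-Schwarz; the [D]
   term is then absorbed by one of the two copies on the left. *)
have h : 2 * sqsum s y <= C * sqsum N (zconv (star f) y) + C^-1 * sqsum N D.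
  rewrite {1}E /sqsum !mulr_sumr -big_split /=; apply: ler_sum => w _.
  set a := zconv _ _ _; rewrite -subr_ge0.
  have -> : C * a ^+ 2 + C^-1 * D w ^+ 2 - 2 * (a * D w) =
    C^-1 * (C * a - D w) ^+ 2 by field; rewrite gt_eqF.
  by rewrite mulr_ge0 ?sqr_ge0// invr_ge0 ltW.
have : C^-1 * sqsum N D <= sqsum s y.
  by rewrite ler_pdivrMl// DC.
by move: h; lra.
Qed.

(** This is the coefficient of f* f at u v^-1. Summing over the support of f, with x = g u, avoids
    the choice of a finite set of rows x. *)
Definition autocorr (R : nzRingType) (G : groupType) (f : ZGamma G) (u v : G) : R :=
  \sum_(g <- finsupp f) (f g)%:~R * zrow R f (g * u)%g v.

Lemma autocorrE (R : nzRingType) (G : groupType) (f : ZGamma G) (N : seq G)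
    (u v : G) : uniq N ->
  (forall g, g \in finsupp f -> (g * u)%g \in N) ->
  autocorr R f u v = \sum_(x <- N) zrow R f x u * zrow R f x v.
Proof.
move=> uN uKN; under [RHS]eq_bigr do rewrite zrowE mulr_suml.
rewrite exchange_big /=; apply: eq_big_seq => g gf.
transitivity (\sum_(x <- N) (x == g * u)%g%:R * ((f g)%:~R * zrow R f x v)).
  by rewrite (sum_delta _ (fun x => (f g)%:~R * zrow R f x v))// uKN.
apply: eq_bigr => x _; rewrite -mulrA; congr (_%:R * _); congr nat_of_bool.
by apply/eqP/eqP => [->|->]; rewrite ?mulgK ?mulgVK.
Qed.

Definition zcover (G : groupType) (f : ZGamma G) (s : seq G) : {fset G} :=
  fset_mulg (finsupp f) [fset u in s]%fset.

Lemma zcoverP (G : groupType) (f : ZGamma G) (s : seq G) (g u : G) :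
  g \in finsupp f -> u \in s -> (g * u)%g \in zcover f s.
Proof. by move=> gf us; apply/imfset2P; exists g => //; exists u; rewrite ?inE. Qed.

Lemma autocorrC (R : comNzRingType) (G : groupType) (f : ZGamma G) (u v : G) :
  autocorr R f u v = autocorr R f v u.
Proof.
pose N := zcover f [:: u; v].
rewrite !(@autocorrE _ _ _ N) ?fset_uniq//.
- by apply: eq_bigr => x _; rewrite mulrC.
- by move=> g gf; rewrite zcoverP// !inE eqxx ?orbT.
- by move=> g gf; rewrite zcoverP// !inE eqxx ?orbT.
Qed.

Lemma quad_autocorr (R : comNzRingType) (G : groupType) (f : ZGamma G)
    (s N : seq G) (y : G -> R) : uniq s -> uniq N ->
  (forall u, u \notin s -> y u = 0) ->
  (forall g u, g \in finsupp f -> u \in s -> (g * u)%g \in N) ->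
  quad (autocorr R f) s y = sqsum N (zconv f y).
Proof.
move=> us uN ys sN; rewrite /quad /sqsum.
transitivity (\sum_(u <- s) \sum_(v <- s) \sum_(x <- N)
    (zrow R f x u * y u) * (zrow R f x v * y v)).
  apply: eq_big_seq => u us'; apply: eq_bigr => v _.
  rewrite (@autocorrE _ _ _ N)// ?mulr_sumr; last by move=> g gf; exact: sN.
  by apply: eq_bigr => x _; ring.
under eq_bigr do rewrite exchange_big /=.
rewrite exchange_big /=; apply: eq_bigr => x _.
rewrite (zconvE (S := s))//; last by move=> g _; exact: ys.
by rewrite expr2 mulr_suml; apply: eq_bigr => u _; rewrite mulr_sumr.
Qed.

Lemma autocorr_pos_def (R : realFieldType) (G : groupType) (f : ZGamma G) :
  bounded_below R f -> pos_def (autocorr R f).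
Proof.
move=> [C C0 fC]; split=> [u v|s y us]; first exact: autocorrC.
move=> /hasP[u us' yu]; pose z u := if u \in s then y u else 0.
rewrite (@eq_quad _ _ _ _ y z); last by move=> v vs; rewrite /z vs.
have zs v : v \notin s -> z v = 0 by rewrite /z => /negbTE ->.
rewrite (@quad_autocorr _ _ _ _ (zcover f s)) ?fset_uniq//; last exact: zcoverP.
rewrite -(pmulr_rgt0 _ C0).
apply: lt_le_trans (fC s _ z us (fset_uniq _) zs (@zcoverP _ f s)).
rewrite /sqsum (bigD1_seq u)//= ltr_wpDr//.
  by apply: sumr_ge0 => v _; rewrite sqr_ge0.
by rewrite /z us' exprn_even_gt0//= yu.
Qed.

(** * Growth of Gram determinants along Folner sequences *)

Local Open Scope classical_set_scope.
Local Open Scope ring_scope.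

Lemma fset_mulgA (G : groupType) (A B C : {fset G}) :
  fset_mulg A (fset_mulg B C) = fset_mulg (fset_mulg A B) C.
Proof.
apply/fsetP => x; apply/imfset2P/imfset2P.
  move=> [a aA [y /imfset2P[b bB [c cC ->]] ->]].
  exists (a * b)%g; first by apply/imfset2P; exists a => //; exists b.
  by exists c => //; rewrite mulgA.
move=> [y /imfset2P[a aA [b bB ->]] [c cC ->]].
exists a => //; exists (b * c)%g; last by rewrite mulgA.
by apply/imfset2P; exists b => //; exists c.
Qed.

Lemma folner_small (R : realType) (G : groupType) (F : nat -> {fset G})
    (K : {fset G}) (e : R) : left_folner R F -> 0 < e ->
  \forall n \near \oo,
    #|` (fset_mulg K (F n) `\` F n)%fset|%:R <= e * #|` F n|%:R.
Proof.
move=> [F0 folF] e0; have [->|K0] := eqVneq K fset0.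
  near=> n; have -> : (fset_mulg fset0 (F n) `\` F n = fset0)%fset.
    by apply/fsetP => x; rewrite !inE; apply/negP => /andP[_ /imfset2P[k]].
  by rewrite cardfs0 mulr_ge0// ltW.
have /cvgrPdist_lt/(_ e e0) := folF K K0.
apply: filterS => n; rewrite sub0r normrN ger0_norm ?divr_ge0//.
have Fn : (0 : R) < #|` F n|%:R by rewrite ltr0n cardfs_gt0.
rewrite ltr_pdivrMr// => /ltW; apply: le_trans; rewrite ler_nat.
by apply: fsubset_leq_card; exact: fsubsetUl.
Unshelve. all: by end_near. Qed.

Lemma gram_intr (R : realType) (G : groupType) (f : ZGamma G) (s : seq G) :
  gram (autocorr R f) s = map_mx intr (gram (autocorr int f) s).
Proof.
apply/matrixP => i j; rewrite !mxE rmorph_sum; apply: eq_bigr => g _ /=.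
by rewrite rmorphM /= /zrow !intz.
Qed.

(** A positive integer is at least 1. Integrality of f thus makes all logarithms of these Gram
    determinants nonnegative. *)
Lemma gram_det_ge1 (R : realType) (G : groupType) (f : ZGamma G) (s : seq G) :
  bounded_below R f -> uniq s -> 1 <= \det (gram (autocorr int f) s).
Proof.
move=> fb us; have := gram_det_gt0 (autocorr_pos_def fb) us.
by rewrite gram_intr det_map_mx ltr0z gtz0_ge1.
Qed.

Definition lgram (R : realType) (G : groupType) (f : ZGamma G) (s : seq G) : R :=
  ln (\det (gram (autocorr R f) s)).
Arguments lgram R {G} f s.

Lemma lgram_ge0 (R : realType) (G : groupType) (f : ZGamma G) (s : seq G) :
  bounded_below R f -> uniq s -> 0 <= lgram R f s.
Proof.
by move=> fb us; rewrite /lgram gram_intr det_map_mx ln_ge0// ler1z (gram_det_ge1 fb).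
Qed.

Lemma lgram_cons (R : realType) (G : groupType) (f : ZGamma G) (P : pred G)
    (x : G) (s : seq G) : bounded_below R f -> uniq (x :: s) -> P x ->
  lgram R f (x :: s) - lgram R f s <=
  lgram R f (seq.filter P (x :: s)) - lgram R f (seq.filter P s).
Proof.
move=> fb uxs Px; have ap := autocorr_pos_def fb.
have us : uniq s by case/andP: uxs.
have gd s' : uniq s' -> \det (gram (autocorr R f) s') \in Num.pos.
  by move=> us'; rewrite posrE gram_det_gt0.
have uf1 := filter_uniq P uxs; have uf2 := filter_uniq P us.
rewrite -!ln_div ?gd// ler_ln ?posrE ?divr_gt0 ?gram_det_gt0//.
exact: gram_det_cons_le.
Qed.

Lemma lgram_nil (R : realType) (G : groupType) (f : ZGamma G) :
  lgram R f [::] = 0.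
Proof. by rewrite /lgram det_mx00 ln1. Qed.

(** [autocorr] depends only on u v^-1, which right translation preserves. *)
Lemma lgram_map (R : realType) (G : groupType) (f : ZGamma G) (s : seq G)
  (h : G) : lgram R f (map (fun u => u * h)%g s) = lgram R f s.
Proof.
have gE n (s' : seq G) : size s' = n -> \det (gram (autocorr R f) s') =
    \det (\matrix_(i < n, j < n) autocorr R f (nth 1%g s' i) (nth 1%g s' j)).
  move=> <-; congr (\det _); apply/matrixP => i j.
  by rewrite !mxE !(tnth_nth 1%g).
rewrite /lgram (gE (size s)) ?size_map// (gE (size s))//.
congr (ln (\det _)); apply/matrixP => i j; rewrite !mxE !(nth_map 1%g)//.
rewrite /autocorr; apply: eq_bigr => g _; rewrite /zrow invgM.
by rewrite !mulgA mulgK.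
Qed.

Lemma lgram_perm (R : realType) (G : groupType) (f : ZGamma G) (s s' : seq G) :
  perm_eq s s' -> lgram R f s = lgram R f s'.
Proof. by move=> ss'; rewrite /lgram (gram_det_perm _ ss'). Qed.

Lemma lgram_le (R : realType) (G : groupType) (f : ZGamma G) :
  bounded_below R f -> exists2 C : R, 0 <= C &
  forall s, uniq s -> lgram R f s <= C * (size s)%:R.
Proof.
move=> fb; exists (lgram R f [:: 1%g]); first exact: lgram_ge0.
elim=> [|x s IH]; first by rewrite lgram_nil mulr0.
move=> uxs; have us : uniq s by case/andP: uxs.
(* Hadamard's inequality: the increment of [x] over [s] is at most its increment over the empty
   family. *)
have := lgram_cons fb uxs (eqxx x); rewrite /= eqxx.
have -> : [seq y <- s | x == y] = [::].
  apply/eqP; rewrite -(negbK (_ == _)) -has_filter; apply/hasP => -[y ys /eqP xy].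
  by case/andP: uxs; rewrite xy ys.
rewrite lgram_nil subr0 lerBlDr => /le_trans; apply.
rewrite -[x]mul1g (lgram_map _ f [:: 1%g] x) -natr1 mulrDr mulr1 addrC.
by rewrite lerD2r IH.
Qed.

(** Shearer's inequality for a submodular function. Adding [x] raises the right side only for the
    [m] indices whose set contains [x], and for each of them by at least the increment over the
    whole of [s]. *)
Lemma lgram_shearer (R : realType) (G : groupType) (f : ZGamma G)
    (I : Type) (L : seq I) (P : I -> pred G) (m : nat) (s : seq G) :
  bounded_below R f -> uniq s ->
  (forall x, x \in s -> count (fun i => P i x) L = m) ->
  m%:R * lgram R f s <= \sum_(i <- L) lgram R f (seq.filter (P i) s).
Proof.
move=> fb; elim: s => [|x s IH] us Pm.
  by rewrite lgram_nil mulr0 big1// => i _; rewrite lgram_nil.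
have us' : uniq s by case/andP: us.
have {}IH := IH us' (fun y ys => Pm y (mem_behead (s := x :: s) ys)).
rewrite -[lgram R f (x :: s)](subrK (lgram R f s)) mulrDr.
rewrite -(Pm x) ?mem_head//.
apply: (@le_trans _ _ (\sum_(i <- L) (if P i x then
   lgram R f (x :: s) - lgram R f s else 0) + m%:R * lgram R f s)).
  by rewrite (Pm x) ?mem_head// lerD2r -big_mkcond /= big_const_seq iter_addr_0
    (Pm x) ?mem_head// mulr_natl.
apply: (@le_trans _ _ (\sum_(i <- L) (if P i x then
   lgram R f (x :: s) - lgram R f s else 0) +
   \sum_(i <- L) lgram R f (seq.filter (P i) s))); first by rewrite lerD2l.
rewrite -big_split /=; apply: ler_sum => i _; case: ifPn => Pix.
  by have := lgram_cons fb us Pix; rewrite /= Pix lerBrDr.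
by rewrite add0r.
Qed.

(** Shearer's inequality for the sets K g with g in K^-1 F, which cover each point of F exactly |K|
    times. Those inside F number at most |F| and each give [lgram R f K] by translation invariance;
    the others are few and are bounded by the linear estimate. *)
Lemma lgram_tiling (R : realType) (G : groupType) (f : ZGamma G) :
  bounded_below R f -> exists2 C : R, 0 <= C &
  forall (K F : {fset G}), K != fset0 ->
   #|` K|%:R * lgram R f F <= #|` F|%:R * lgram R f K +
     C * #|` K|%:R * #|` K|%:R *
     #|` (fset_mulg K (fset_mulg [fset (k^-1)%g | k in K] F) `\` F)%fset|%:R.
Proof.
move=> fb; have [C C0 CP] := lgram_le fb; exists C => // K F K0.
set L := fset_mulg [fset (k^-1)%g | k in K]%fset F.
pose Bd := (fset_mulg K L `\` F)%fset; rewrite -/Bd.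
pose P (g : G) : pred G := fun x => (x * g^-1)%g \in K.
have cnt x : x \in enum_fset F -> count (fun g => P g x) L = #|` K|.
  move=> xF; rewrite -size_filter -(size_map (fun k => k^-1 * x)%g K).
  apply/perm_size/uniq_perm; first by rewrite filter_uniq// fset_uniq.
    rewrite map_inj_uniq ?fset_uniq// => k k' /mulIg; exact: invg_inj.
  move=> g; rewrite mem_filter /P; apply/andP/mapP => [[xgK _]|[k kK ->]].
    by exists (x * g^-1)%g => //; rewrite invgF mulgVK.
  split; first by rewrite invgM invgK mulVKg.
  by apply/imfset2P; exists (k^-1)%g; [apply/imfsetP; exists k|exists x].
apply: le_trans (lgram_shearer fb (fset_uniq F) cnt) _.
pose inner (g : G) := all (fun k => (k * g)%g \in F) K.
rewrite (bigID inner) /=; apply: lerD.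
  apply: (@le_trans _ _ (\sum_(g <- L | inner g) lgram R f K)).
    rewrite big_seq_cond [leRHS]big_seq_cond; apply: ler_sum => g /andP[_ /allP ig].
    rewrite -(lgram_map _ f K g) le_eqVlt; apply/orP; left; apply/eqP.
    apply: lgram_perm; apply: uniq_perm.
    - by rewrite filter_uniq// fset_uniq.
    - by rewrite map_inj_uniq ?fset_uniq//; exact: mulIg.
    - move=> x; rewrite mem_filter /P; apply/andP/mapP => [[xgK xF]|[k kK ->]].
        by exists (x * g^-1)%g => //; rewrite mulgVK.
      by rewrite mulgK; split=> //; exact: ig.
  rewrite -big_filter big_const_seq count_predT iter_addr_0 -[leLHS]mulr_natl.
  rewrite ler_wpM2r ?lgram_ge0 ?fset_uniq// ler_nat.
  have [k0 k0K] := fset0Pn _ K0.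
  rewrite -(size_map (fun g => k0 * g)%g).
  apply: uniq_leq_size.
    by rewrite map_inj_uniq ?filter_uniq ?fset_uniq//; exact: mulgI.
  move=> _ /mapP[g + ->]; rewrite mem_filter => /andP[/allP ig _].
  exact: ig.
apply: (@le_trans _ _ (\sum_(g <- L | ~~ inner g) C * #|` K|%:R)).
  apply: ler_sum => g _; apply: le_trans (CP _ (filter_uniq _ (fset_uniq F))) _.
  rewrite ler_wpM2l// ler_nat.
  rewrite -(size_map (fun x => x * g^-1)%g); apply: uniq_leq_size.
    by rewrite map_inj_uniq ?filter_uniq ?fset_uniq//; exact: mulIg.
  by move=> _ /mapP[x + ->]; rewrite mem_filter => /andP[].
(* If K g is not inside F, some b = k g lies in [Bd], and g = k^-1 b; so there are at most |K| |Bd|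
   such g. *)
rewrite -big_filter big_const_seq count_predT iter_addr_0 -[leLHS]mulr_natr -!mulrA.
rewrite ler_wpM2l// ler_wpM2l// -natrM ler_nat.
rewrite -(size_allpairs (fun k b => k^-1 * b)%g K Bd).
apply: uniq_leq_size; first by rewrite filter_uniq ?fset_uniq.
move=> g; rewrite mem_filter => /andP[/allPn[k kK kg] gL].
apply/allpairsP; exists (k, k * g)%g; split=> //=; last by rewrite mulKg.
by rewrite !inE kg /=; apply/imfset2P; exists k => //; exists g.
Qed.

Lemma lgram_cvg (R : realType) (G : groupType) (f : ZGamma G)
    (F : nat -> {fset G}) : bounded_below R f -> left_folner R F ->
  exists L : R, forall e : R, 0 < e ->
    \forall n \near \oo, `|lgram R f (F n) / #|` F n|%:R - L| <= e.
Proof.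
move=> fb folF; have [F0 _] := folF; have [C C0 CP] := lgram_tiling fb.
have Fn n : (0 : R) < #|` F n|%:R by rewrite ltr0n cardfs_gt0.
pose a n := lgram R f (F n) / #|` F n|%:R.
have a0 n : 0 <= a n by rewrite divr_ge0 ?lgram_ge0 ?fset_uniq// ltW.
have hinf : has_inf (range a).
  by split; [exists (a 0%N), 0%N | exists 0 => _ [n _ <-]].
(* The limit is the infimum of the rates along the sequence itself: a nearly optimal member [F k]
   serves as the tile for all later ones. *)
exists (inf (range a)) => e e0.
have [_ [k _ <-] ak] := inf_adherent (divr_gt0 e0 (ltr0n _ 2)) hinf.
set K := F k.
pose c := C * #|` K|%:R.
have c0 : 0 <= c by rewrite mulr_ge0// ltW.
have e' : 0 < e / 2 / (c + 1) by rewrite !divr_gt0// ltr_pwDr.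
have := folner_small (fset_mulg K [fset (k^-1)%g | k in K]%fset) folF e'.
apply: filterS => n hn; rewrite -/(a n).
have inf_le : inf (range a) <= a n.
  by apply: ge_inf; [exact: (proj2 hinf) | exists n].
rewrite ger0_norm ?subr_ge0// lerBlDr.
suff : a n <= a k + e / 2 by move: ak; lra.
have := CP K (F n) (F0 k).
rewrite fset_mulgA.
set B : R := (X in _ <= _ + _ * X); move=> hK.
have {}hn : B <= e / 2 / (c + 1) * #|` F n|%:R by [].
have Kn : (0 : R) < #|` K|%:R by exact: Fn.
rewrite /a ler_pdivrMr// -(ler_pM2l Kn); apply: (le_trans hK).
have -> : #|` F n|%:R * lgram R f K = #|` K|%:R * (a k * #|` F n|%:R).
  by rewrite /a -/K; field; rewrite gt_eqF.
rewrite mulrDl mulrDr lerD2l -(mulrC #|` K|%:R) -!mulrA.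
rewrite ler_pM2l// mulrA -/c [e * _]mulrA.
apply: (@le_trans _ _ (c * (e / 2 / (c + 1) * #|` F n|%:R))).
  by rewrite ler_wpM2l.
rewrite mulrA; apply: ler_wpM2r; first exact: ltW.
rewrite mulrCA ger_pMr ?divr_gt0//.
by rewrite ler_pdivrMr ?mul1r ?lerDl// ltr_pwDr.
Qed.

(** * Largest minors and their growth rate *)

Definition zmx (R : nzRingType) (G : groupType) (f : ZGamma G) m k
    (x : 'I_m -> G) (u : 'I_k -> G) : 'M[R]_(m, k) :=
  \matrix_(i, j) zrow R f (x i) (u j).
Arguments zmx R {G} f {m k} x u.

(** All row selections are allowed: a repeated row gives determinant 0 and reordering changes only
    the sign, so the value is that of the largest minor. *)
Definition max_minor (G : groupType) (f : ZGamma G) (S : seq G) : nat :=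
  \max_(r : {ffun 'I_(size S) -> 'I_(size (zcover f S))})
    `|\det (zmx int f (fun i => tnth (in_tuple (zcover f S)) (r i))
             (tnth (in_tuple S)))|%N.

Lemma zmx_intr (R : nzRingType) (G : groupType) (f : ZGamma G) m k
    (x : 'I_m -> G) (u : 'I_k -> G) :
  zmx R f x u = map_mx intr (zmx int f x u).
Proof. by apply/matrixP => i j; rewrite !mxE /zrow intz. Qed.

Lemma zrow_out (R : nzRingType) (G : groupType) (f : ZGamma G) (S : seq G)
    (x u : G) : u \in S -> x \notin zcover f S -> zrow R f x u = 0.
Proof.
move=> uS xN; rewrite /zrow; case: finsuppP => // xuf; case/negP: xN.
by rewrite -(mulgVK u x) zcoverP.
Qed.

(** Rows outside [zcover f S] vanish, so restricting the maximum to that set loses nothing. *)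
Lemma le_max_minor (G : groupType) (f : ZGamma G) (S : seq G)
    (x : 'I_(size S) -> G) :
  (`|\det (zmx int f x (tnth (in_tuple S)))| <= max_minor f S)%N.
Proof.
have [|/forallPn[i xi]] := boolP [forall i, x i \in zcover f S].
  move=> /forallP xN.
  have idx i : (index (x i) (zcover f S) < size (zcover f S))%N by rewrite index_mem.
  pose r : {ffun 'I_(size S) -> 'I_(size (zcover f S))} := [ffun i => Ordinal (idx i)].
  have -> : zmx int f x (tnth (in_tuple S)) =
      zmx int f (fun i => tnth (in_tuple (zcover f S)) (r i)) (tnth (in_tuple S)).
    apply/matrixP => i j; rewrite !mxE; congr (zrow _ _ _ _).
    by rewrite (tnth_nth (x i)) ffunE /= nth_index// xN.
  exact: (@leq_bigmax _ (fun r : {ffun 'I_(size S) -> 'I_(size (zcover f S))} =>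
    `|\det (zmx int f (fun i => tnth (in_tuple (zcover f S)) (r i))
             (tnth (in_tuple S)))|%N)).
rewrite (expand_det_row _ i) big1// => j _.
by rewrite mxE (zrow_out _ (mem_tnth j (in_tuple S)) xi) mul0r.
Qed.

Lemma gram_zmx (G : groupType) (f : ZGamma G) (S : seq G) (N : seq G) :
  uniq N -> (forall g u, g \in finsupp f -> u \in S -> (g * u)%g \in N) ->
  gram (autocorr int f) S =
  (zmx int f (tnth (in_tuple N)) (tnth (in_tuple S)))^T *m
   zmx int f (tnth (in_tuple N)) (tnth (in_tuple S)).
Proof.
move=> uN SN; apply/matrixP => i j; rewrite !mxE.
rewrite (@autocorrE _ _ _ N)//; last first.
  by move=> g gf; rewrite SN//; exact: (mem_tnth i (in_tuple S)).
by rewrite (big_tnth _ _ N); apply: eq_bigr => l _; rewrite !mxE.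
Qed.

(** In the Cauchy-Binet sum over row selections, the k! reorderings of the best one give the lower
    bound. For the upper bound, only injective selections contribute, and there are k! times a
    binomial coefficient of them. *)
Lemma max_minor_gram (G : groupType) (f : ZGamma G) (S : seq G) :
  uniq S ->
  ((max_minor f S)%:Z ^+ 2 <= \det (gram (autocorr int f) S) <=
    'C(#|` zcover f S|, size S)%:Z * (max_minor f S)%:Z ^+ 2).
Proof.
move=> uS; set N := zcover f S; set k := size S.
pose B := zmx int f (tnth (in_tuple N)) (tnth (in_tuple S)).
have gE : gram (autocorr int f) S = B^T *m B.
  by apply: gram_zmx; [exact: fset_uniq|exact: zcoverP].
pose d (r : {ffun 'I_k -> 'I_(size N)}) := \det (rowsub r B).
have MdE : max_minor f S = \max_(r : {ffun 'I_k -> 'I_(size N)}) `|d r|%N.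
  apply: eq_bigr => r _; congr absz; congr (\det _).
  by apply/matrixP => i j; rewrite !mxE.
have CB := cauchy_binet_fact B.
have kf : 0 < k`!%:R :> int by rewrite ltr0n fact_gt0.
have dninj (r : {ffun 'I_k -> 'I_(size N)}) : ~~ injectiveb r -> d r = 0.
  case/injectivePn => i [j ij rij]; apply: (determinant_alternate ij) => l.
  by rewrite !mxE rij.
apply/andP; split; rewrite -(ler_pM2l kf) gE CB.
  have [->|M0] := eqVneq (max_minor f S) 0%N.
    by rewrite expr0n mulr0 sumr_ge0// => r _; rewrite sqr_ge0.
  have [r rE] : exists r, max_minor f S = `|d r|%N.
    have T0 : (0 < #|{ffun 'I_k -> 'I_(size N)}|)%N.
      rewrite lt0n; apply: contraNN M0 => /eqP/card0_eq h.
      by rewrite MdE big1// => r _; have := h r; rewrite inE.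
    by have [r rE] := bigop.eq_bigmax (fun r => `|d r|%N) T0; exists r; rewrite MdE.
  have rinj : injective r.
    apply/injectiveP; apply: contraNT M0 => /dninj dr0.
    by rewrite rE dr0.
  pose rs (s : 'S_k) : {ffun 'I_k -> 'I_(size N)} := [ffun i => r (s i)].
  have rsinj : injective rs.
    move=> s s' /ffunP ss'; apply/permP => i; apply: rinj.
    by have := ss' i; rewrite !ffunE.
  apply: (@le_trans _ _ (\sum_(q in [set rs s | s : 'S_k]%SET) d q ^+ 2)).
    rewrite big_imset /=; last by move=> s s' _ _; exact: rsinj.
    rewrite (eq_bigr (fun=> (max_minor f S)%:Z ^+ 2)); last first.
      move=> s _; have -> : d (rs s) = (-1) ^+ s * d r.
        rewrite /d -det_perm -det_mulmx -row_permE; congr (\det _).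
        by apply/matrixP => i j; rewrite !mxE ffunE.
      by rewrite exprMn sqrr_sign mul1r rE abszE real_normK ?num_real.
    by rewrite sumr_const card_Sn mulr_natl.
  rewrite big_mkcond; apply: ler_sum => q _; case: ifP => // _.
  exact: sqr_ge0.
rewrite (bigID (fun r : {ffun 'I_k -> 'I_(size N)} => injectiveb r)) /= [X in _ + X]big1 ?addr0; last first.
  by move=> r /dninj; rewrite /d => ->; rewrite expr0n.
apply: (@le_trans _ _ (\sum_(r : {ffun 'I_k -> 'I_(size N)} | injectiveb r)
    (max_minor f S)%:Z ^+ 2)).
  apply: ler_sum => r _; rewrite -real_normK ?num_real// -abszE lerXn2r ?nnegrE//.
  by rewrite lez_nat MdE; exact: (@leq_bigmax _ (fun r => `|d r|%N)).
rewrite sumr_const mulrA -[leLHS]mulr_natl.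
have -> : #|[pred r : {ffun 'I_k -> 'I_(size N)} | injectiveb r]| =
    (size N ^_ k)%N.
  have := card_inj_ffuns 'I_k 'I_(size N).
  by rewrite !card_ord cardsE.
by rewrite -bin_ffact !natz PoszM [_%:Z * _%:Z]mulrC.
Qed.

(** From 'C(n, k) t^(n-k) <= (1 + t)^n the logarithm is at most t n - (n - k) ln t. Each term is at
    most e k / 2: the first by [t <= e / 4] and n <= 2 k, the second by the choice of [d] once [t]
    is fixed. *)
Lemma ln_binomial_small (R : realType) (e : R) : 0 < e ->
  exists2 d : R, 0 < d & forall n k : nat, (k <= n)%N ->
    n%:R <= k%:R + d * k%:R -> ln ('C(n, k)%:R : R) <= e * k%:R.
Proof.
move=> e0; pose t := Num.min (e / 4) (1 / 2).
have t0 : 0 < t by rewrite lt_min !divr_gt0.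
have t1 : t < 1 by rewrite gt_min; apply/orP; right; lra.
have te : t <= e / 4 by rewrite ge_min lexx.
have lnt : ln t <= 0 by rewrite ln_le0// ltW.
have q0 : 0 < 1 - ln t by lra.
pose d := Num.min 1 (e / 2 / (1 - ln t)).
have d0 : 0 < d by rewrite lt_min ltr01 !divr_gt0.
have d1 : d <= 1 by rewrite ge_min lexx.
have dt : d * - ln t <= e / 2.
  apply: (@le_trans _ _ (d * (1 - ln t))).
    by rewrite ler_wpM2l ?ltW//; lra.
  by rewrite -ler_pdivlMr// ge_min lexx orbT.
exists d => // n k kn nk.
have Cpos : (0 : R) < 'C(n, k)%:R by rewrite ltr0n bin_gt0.
have tp : 1 + t > 0 by rewrite addr_gt0.
have h : ln 'C(n, k)%:R + ln t *+ (n - k) <= ln (1 + t) *+ n.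
  rewrite -!lnXn// -lnM ?posrE ?exprn_gt0//.
  rewrite ler_ln ?posrE ?mulr_gt0 ?exprn_gt0//.
  by rewrite -(bin_sub kn); apply: binomial_count; exact: ltW.
have ht : ln (1 + t) <= t by rewrite le_ln1Dx//; lra.
have : ln (1 + t) *+ n <= t * n%:R by rewrite -[leLHS]mulr_natr ler_wpM2r.
have : ln t *+ (n - k) = - (- ln t * (n - k)%:R) by rewrite mulNr opprK mulr_natr.
have nk' : (n - k)%:R <= d * k%:R :> R by rewrite natrB//; lra.
have : - ln t * (n - k)%:R <= - ln t * (d * k%:R) by rewrite ler_wpM2l//; lra.
have : t * n%:R <= e / 4 * (k%:R + d * k%:R).
  by apply: ler_pM => //; rewrite ?ltW.
have : - ln t * (d * k%:R) <= e / 2 * k%:R by rewrite mulrA (mulrC _ d) ler_wpM2r.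
have : e / 4 * (k%:R + d * k%:R) <= e / 4 * (2 * k%:R).
  apply: ler_wpM2l; first by rewrite divr_ge0// ltW.
  by rewrite mulr_natl mulr2n lerD2l ler_piMl.
by move: h; lra.
Qed.

Lemma lgramE (R : realType) (G : groupType) (f : ZGamma G) (S : seq G) :
  lgram R f S = ln (\det (gram (autocorr int f) S))%:~R.
Proof. by rewrite /lgram gram_intr det_map_mx. Qed.

Lemma max_minor_lgram (R : realType) (G : groupType) (f : ZGamma G) (S : seq G) :
  bounded_below R f -> uniq S ->
  [/\ (0 < max_minor f S)%N, (size S <= #|` zcover f S|)%N,
      2 * ln (max_minor f S)%:R <= lgram R f S &
      lgram R f S <= ln 'C(#|` zcover f S|, size S)%:R
                     + 2 * ln (max_minor f S)%:R].
Proof.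
move=> fb uS; have /andP[le1 le2] := max_minor_gram f uS.
have g1 := gram_det_ge1 fb uS.
have h := le_trans g1 le2.
have M0 : (0 < max_minor f S)%N.
  rewrite lt0n; apply: contraTneq h => ->.
  by rewrite expr0n mulr0.
have C0 : (0 < 'C(#|` zcover f S|, size S))%N.
  rewrite lt0n; apply: contraTneq h => ->.
  by rewrite mul0r.
have MR : (0 : R) < (max_minor f S)%:R by rewrite ltr0n.
have CR : (0 : R) < 'C(#|` zcover f S|, size S)%:R by rewrite ltr0n.
have E : 2 * ln (max_minor f S)%:R = ln ((max_minor f S)%:R ^+ 2 : R).
  by rewrite lnXn// mulr_natl.
have MZ : (max_minor f S)%:R ^+ 2 = ((max_minor f S)%:Z ^+ 2)%:~R :> R.
  by rewrite rmorphXn /= -pmulrn.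
have CZ : 'C(#|` zcover f S|, size S)%:R =
  ('C(#|` zcover f S|, size S)%:Z)%:~R :> R by rewrite -pmulrn.
have detR : (0 : R) < (\det (gram (autocorr int f) S))%:~R.
  by rewrite ltr0z (lt_le_trans _ g1).
split=> //; first by rewrite -bin_gt0.
- rewrite E lgramE ler_ln ?posrE ?exprn_gt0//.
  by rewrite MZ ler_int.
- rewrite E -lnM ?posrE ?exprn_gt0// lgramE ler_ln ?posrE ?mulr_gt0 ?exprn_gt0//.
  by rewrite MZ CZ -rmorphM ler_int.
Qed.

Lemma max_minor_cvg (R : realType) (G : groupType) (f : ZGamma G)
    (F : nat -> {fset G}) : bounded_below R f -> left_folner R F ->
  exists2 L : R, 0 <= L & forall e : R, 0 < e ->
    \forall n \near \oo,
      `|ln (max_minor f (F n))%:R / #|` F n|%:R - L| <= e.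
Proof.
move=> fb folF; have [F0 _] := folF; have [L FL] := lgram_cvg fb folF.
have Fn n : (0 : R) < #|` F n|%:R by rewrite ltr0n cardfs_gt0.
have main e : 0 < e -> \forall n \near \oo,
    `|ln (max_minor f (F n))%:R / #|` F n|%:R - L / 2| <= e.
  move=> e0; have [d d0 dP] := ln_binomial_small e0.
  have h1 := FL e e0; have h2 := folner_small (finsupp f) folF d0.
  apply: filterS2 h1 h2 => n h1 h2.
  have [M0 sz lo hi] := max_minor_lgram fb (fset_uniq (F n)).
  have zE : zcover f (F n) = fset_mulg (finsupp f) (F n).
    by congr fset_mulg; apply/fsetP => x; rewrite !inE.
  have /(dP _ _ sz) hC : #|` zcover f (F n)|%:R <= #|` F n|%:R + d * #|` F n|%:R.
    apply: (@le_trans _ _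
      (#|` F n| + #|` (fset_mulg (finsupp f) (F n) `\` F n)%fset|)%N%:R).
      rewrite zE ler_nat -leq_subLR cardfsD leq_sub2l//.
      by rewrite fsubset_leq_card// fsubsetIr.
    by rewrite natrD lerD2l.
  move: h1; rewrite !ler_norml => /andP[h1a h1b].
  have Fn0 := Fn n.
  have LE : lgram R f (F n) = lgram R f (F n) / #|` F n|%:R * #|` F n|%:R.
    by rewrite divfK// gt_eqF.
  rewrite lerBrDr lerBlDr ler_pdivlMr// ler_pdivrMr//.
  have := ler_wpM2r (ltW Fn0) h1a; have := ler_wpM2r (ltW Fn0) h1b.
  rewrite !mulrBl -LE !mulrDl => h3 h4.
  by apply/andP; split; lra.
exists (L / 2) => //; apply/ler_addgt0Pr => e e0.
have [N _ /(_ N (leqnn N))] := main e e0.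
have [M0 _ _ _] := max_minor_lgram fb (fset_uniq (F N)).
rewrite ler_norml => /andP[_]; have : 0 <= ln (max_minor f (F N))%:R / #|` F N|%:R :> R.
  by rewrite divr_ge0// ln_ge0// ler1n.
by lra.
Qed.

(** * Solving convolution equations in l2 *)

Lemma Re_sum (R : realType) (I : Type) (s : seq I) (F : I -> R[i]) :
  complex.Re (\sum_(i <- s) F i) = \sum_(i <- s) complex.Re (F i).
Proof.
elim: s => [|i s IH]; first by rewrite !big_nil.
by rewrite !big_cons -IH; case: (F i); case: (\sum_(_ <- _) _).
Qed.

Lemma Re_realM (R : realType) (x : R) (w : R[i]) :
  complex.Re (real_complex R x * w) = x * complex.Re w.
Proof. by case: w => a b /=; rewrite mul0r subr0. Qed.

Lemma Re_intM (R : realType) (n : int) (w : R[i]) :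
  complex.Re (n%:~R * w) = n%:~R * complex.Re w.
Proof. by rewrite -Re_realM rmorph_int. Qed.

Lemma l2_sum_seq (R : realType) (G : choiceType) (xi : G -> R[i]^o)
    (s : seq G) : uniq s -> (forall u, u \notin s -> xi u = 0) ->
  l2_sum xi = (\sum_(u <- s) abs2 (xi u))%:E.
Proof.
move=> us xis; rewrite /l2_sum.
transitivity (\esum_(u in [set` s]) (abs2 (xi u))%:E)%E.
  rewrite [RHS]esum_mkcond; apply: eq_esum => u _.
  case: ifPn => // /negP us'; rewrite xis ?/abs2 /= ?expr0n ?addr0//.
  by apply/negP => us''; apply: us'; rewrite inE.
rewrite esum_fset//; last by move=> u _; rewrite lee_fin abs2_ge0.
by rewrite -fsbig_seq// -sumEFin.
Qed.

Lemma l2_sum_fin_num (R : realType) (G : choiceType) (xi : l2 R G) :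
  l2_sum xi \is a fin_num.
Proof.
have /asboolP xilt := l2_funP xi; rewrite ge0_fin_numE//.
by apply: esum_ge0 => u _; rewrite lee_fin abs2_ge0.
Qed.

Lemma sqsum_Re_le (R : realType) (G : choiceType) (xi : l2 R G) (s : seq G) :
  uniq s -> sqsum s (fun u => complex.Re (xi u)) <= l2norm xi ^+ 2.
Proof.
move=> us; have l0 : (0 <= l2_sum xi)%E.
  by apply: esum_ge0 => u _; rewrite lee_fin abs2_ge0.
rewrite /l2norm sqr_sqrtr ?fine_ge0// -lee_fin fineK ?l2_sum_fin_num//.
apply: (@le_trans _ _ (\sum_(u <- s) (abs2 (xi u))%:E)%E).
  rewrite sumEFin lee_fin; apply: ler_sum => u _.
  by rewrite /abs2 lerDl sqr_ge0.
rewrite fsbig_seq//; apply: ereal_sup_ubound; exists [set` s] => //.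
Qed.

Definition embed_fun (R : realType) (G : choiceType) (s : seq G) (z : G -> R) :
  G -> R[i]^o := fun u => if u \in s then real_complex R (z u) else 0.

Lemma embed_subproof (R : realType) (G : choiceType) (s : seq G) (z : G -> R) :
  embed_fun s z \in @l2_pred R G.
Proof.
apply/asboolP; rewrite (@l2_sum_seq _ _ _ (undup s)) ?undup_uniq ?ltry//.
by move=> u; rewrite mem_undup /embed_fun => /negbTE ->.
Qed.

Definition embed (R : realType) (G : choiceType) (s : seq G) (z : G -> R) :
  l2 R G := L2 (embed_subproof s z).

Lemma l2norm_embed (R : realType) (G : choiceType) (s : seq G) (z : G -> R) :
  uniq s -> l2norm (embed s z) ^+ 2 = sqsum s z.
Proof.
move=> us; rewrite /l2norm (@l2_sum_seq _ _ _ s)//; last first.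
  by move=> u /negbTE us'; rewrite /= /embed_fun us'.
have -> : \sum_(u <- s) abs2 (embed s z u) = sqsum s z.
  apply: eq_big_seq => u us'.
  by rewrite /= /embed_fun us' /abs2 /= expr0n addr0.
by rewrite sqr_sqrtr ?sqsum_ge0.
Qed.

Lemma l2P (R : realType) (G : choiceType) (x y : l2 R G) :
  (forall u, x u = y u) -> x = y.
Proof. by move=> xy; apply/val_inj/funext. Qed.

Lemma embed_cons (R : realType) (G : choiceType) (x : G) (s : seq G)
    (z : G -> R) : x \notin s ->
  embed (x :: s) z = real_complex R (z x) *: embed [:: x] (fun=> 1) + embed s z.
Proof.
move=> xs; apply: l2P => u.
rewrite [RHS]/(real_complex R (z x) * embed_fun [:: x] (fun=> 1) u + embed_fun s z u).
rewrite [LHS]/(embed_fun (x :: s) z u) /embed_fun !inE.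
have H1 (a : R[i]) : a = a * 1 + 0 by rewrite mulr1 addr0.
have H2 (a b : R[i]) : b = a * 0 + b by rewrite mulr0 add0r.
have [->|ux] := eqVneq u x; last exact: H2.
by rewrite (negbTE xs) orTb; exact: H1.
Qed.

Lemma linear_embed (R : realType) (G : choiceType) (T : l2 R G -> l2 R G)
    (s : seq G) (z : G -> R) (y : G) : linear T -> uniq s ->
  complex.Re (T (embed s z) y) =
  \sum_(u <- s) z u * complex.Re (T (embed [:: u] (fun=> 1)) y).
Proof.
move=> Tlin; elim: s => [|x s IH].
  move=> _; rewrite big_nil.
  have -> : embed [::] z = 0 by apply: l2P => u.
  have -> : T 0 = 0.
    by have := Tlin (-1) 0 0; rewrite scaler0 addr0 scaleN1r addNr.
  by [].
move=> /= /andP[xs us]; rewrite embed_cons// Tlin big_cons -IH//.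
rewrite -Re_realM.
set a := T _; set b := T _; rewrite -[(_ *: a + b) y]/(real_complex R (z x) * a y + b y).
by case: (_ * _) => ? ?; case: (b y).
Qed.

Lemma finsupp_complexify (R : realType) (G : groupType) (f : ZGamma G) :
  finsupp (complexify R f) = finsupp f.
Proof.
apply/fsetP => g; rewrite !mem_finsupp complexifyE.
by rewrite -(intr_eq0 R[i]).
Qed.

(** Since f has real coefficients, real parts commute with convolution; this is the passage from
    complex l2 to real functions. *)
Lemma Re_lmul (R : realType) (G : groupType) (f : ZGamma G) (xi : l2 R G)
    (x : G) :
  complex.Re (lmul (complexify R f) xi x) =
  zconv f (fun u => complex.Re (xi u)) x.
Proof.
rewrite /= /Defs.conv Re_sum finsupp_complexify; apply: eq_bigr => g _.
by rewrite complexifyE Re_intM.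
Qed.

Lemma bounded_sq (R : realType) (G : choiceType) (T : l2 R G -> l2 R G) :
  bounded_op T -> exists2 C : R, 0 < C &
    forall xi, l2norm (T xi) ^+ 2 <= C * l2norm xi ^+ 2.
Proof.
move=> [_ [M MP]]; exists (M ^+ 2 + 1); first by rewrite ltr_wpDl ?sqr_ge0.
move=> xi; apply: (@le_trans _ _ (M ^+ 2 * l2norm xi ^+ 2)); last first.
  by rewrite ler_wpM2r ?sqr_ge0// lerDl.
by rewrite -exprMn lerXn2r ?nnegrE ?(le_trans _ (MP xi))//; apply: sqrtr_ge0.
Qed.

Lemma right_inverse_solvable (R : realType) (G : groupType) (f : ZGamma G)
    (T : l2 R G -> l2 R G) : bounded_op T ->
  cancel T (lmul (complexify R f)) -> solvable R f.
Proof.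
move=> /bounded_sq[C C0 CP] fT; exists C => // s z us zs.
exists (fun u => complex.Re (T (embed s z) u)).
  move=> x; rewrite -Re_lmul fT /= /embed_fun; case: ifPn => //.
  by move=> /zs ->.
move=> S uS; apply: le_trans (sqsum_Re_le _ uS) _.
by rewrite -(l2norm_embed z us).
Qed.

(* The solutions for the adjoint come from the adjoint of T, whose matrix
   coefficients are those of T. *)
Lemma left_inverse_solvable_star (R : realType) (G : groupType) (f : ZGamma G)
    (T : l2 R G -> l2 R G) : bounded_op T ->
  cancel (lmul (complexify R f)) T -> solvable R (star f).
Proof.
move=> Tb Tf; have [C C0 CP] := bounded_sq Tb; have [Tlin _] := Tb.
pose tau x y := complex.Re (T (embed [:: x] (fun=> 1)) y).
(* This is T f = 1 evaluated on the point mass at [x], which f sends to the combination of the point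
   masses at [g * x] with coefficients [f g]. *)
have key x y : \sum_(g <- finsupp f) (f g)%:~R * tau (g * x)%g y = (y == x)%:R.
  have -> : (y == x)%:R = complex.Re (embed [:: x] (fun=> 1 : R) y).
    by rewrite /= /embed_fun inE; case: eqP.
  rewrite -[in RHS](Tf (embed [:: x] (fun=> 1))).
  pose S := [seq (g * x)%g | g <- finsupp f].
  have -> : lmul (complexify R f) (embed [:: x] (fun=> 1)) =
      embed S (fun u => zrow R f u x).
    apply: l2P => u.
    rewrite [LHS]/(Defs.conv (complexify R f) (embed_fun [:: x] (fun=> 1)) u).
    rewrite [RHS]/(embed_fun S (fun u => zrow R f u x) u).
    rewrite /Defs.conv finsupp_complexify /embed_fun.
    under eq_bigr => g _.
      rewrite complexifyE inE (_ : (g^-1 * u == x)%g = (g == u * x^-1)%g).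
        rewrite (_ : (if _ then _ else _) = (g == u * x^-1)%g%:R :> R[i]).
          rewrite mulrC. over.
        by case: ifP.
      apply/eqP/eqP => [<-|->]; first by rewrite invgM invgK mulVKg.
      by rewrite invgM invgK mulgVK.
    rewrite (sum_delta _ (fun g => (f g)%:~R : R[i])) ?fset_uniq//.
    have -> : ((u * x^-1)%g \in enum_fset (finsupp f)) = (u \in S).
      apply/idP/mapP => [uf|[g gf ->]]; last by rewrite mulgK.
      by exists (u * x^-1)%g => //; rewrite mulgVK.
    by rewrite /zrow rmorph_int.
  rewrite linear_embed//; last by rewrite map_inj_uniq ?fset_uniq//; exact: mulIg.
  by rewrite big_map; apply: eq_bigr => g _; rewrite /zrow mulgK.
exists C => // s z us zs.
pose D x := \sum_(y <- s) z y * tau x y.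
exists D.
  move=> x; rewrite /zconv.
  have pe : perm_eq (finsupp (star f)) [seq (g^-1)%g | g <- finsupp f].
    apply: uniq_perm; first exact: fset_uniq.
      by rewrite map_inj_uniq ?fset_uniq//; exact: invg_inj.
    move=> g; rewrite finsupp_star -[in RHS](invgK g).
    by rewrite (mem_map invg_inj).
  rewrite (perm_big _ pe) big_map /=.
  transitivity (\sum_(y <- s) z y * \sum_(g <- finsupp f) (f g)%:~R * tau (g * x)%g y).
    under [RHS]eq_bigr do rewrite mulr_sumr.
    rewrite exchange_big /=; apply: eq_bigr => g _.
    rewrite starE !invgK /D mulr_sumr; apply: eq_bigr => y _.
    by rewrite mulrCA.
  under eq_bigr do rewrite key mulrC.
  by rewrite (sum_delta _ z)//; case: ifPn => // /zs.
move=> S uS.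
(* Testing [D] against its own truncation to [S] moves the adjoint back onto [T], whose bound
   applies to the finitely supported [embed S D]; summability of [D] need not be known
   beforehand. *)
pose w y := complex.Re (T (embed S D) y).
have E : sqsum S D = \sum_(y <- s) z y * w y.
  rewrite /sqsum; under eq_bigr => x _ do rewrite expr2 {2}/D mulr_sumr.
  rewrite exchange_big /=; apply: eq_bigr => y _.
  rewrite /w linear_embed// mulr_sumr; apply: eq_bigr => x _.
  by rewrite mulrCA.
have w2 : sqsum s w <= C * sqsum S D.
  apply: le_trans (sqsum_Re_le _ us) _.
  by rewrite -(l2norm_embed D uS).
have h : 2 * sqsum S D <= C * sqsum s z + C^-1 * sqsum s w.
  rewrite E /sqsum !mulr_sumr -big_split /=; apply: ler_sum => y _.
  rewrite -subr_ge0.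
  have -> : C * z y ^+ 2 + C^-1 * w y ^+ 2 - 2 * (z y * w y) =
    C^-1 * (C * z y - w y) ^+ 2 by field; rewrite gt_eqF.
  by rewrite mulr_ge0 ?sqr_ge0// invr_ge0 ltW.
have : C^-1 * sqsum s w <= sqsum S D by rewrite ler_pdivrMl.
by move: h; lra.
Qed.

Lemma invertible_solvable (R : realType) (G : groupType) (f : ZGamma G) :
  invertible_in_LGamma R f -> solvable R f /\ solvable R (star f).
Proof.
move=> [T [Tb _] [Tf fT]]; split; first exact: right_inverse_solvable Tb fT.
exact: left_inverse_solvable_star Tb Tf.
Qed.

(** * Real lifts of points and Lebesgue numbers *)

Definition mod1 (R : realType) (x : R) : RmodZ R :=
  \pi_({ideal_quot (@Num.int_num_subdef R : {pred R})}%type)%qT x.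

Lemma mod1D (R : realType) (x y : R) : mod1 (x + y) = mod1 x + mod1 y.
Proof. exact: Quotient.pi_add. Qed.

Lemma mod1N (R : realType) (x : R) : mod1 (- x) = - mod1 x.
Proof. exact: Quotient.pi_opp. Qed.

Lemma mod1_0 (R : realType) : mod1 (0 : R) = 0.
Proof. by apply: (addrI (mod1 0)); rewrite -mod1D !addr0. Qed.

Lemma mod1_sum (R : realType) (I : Type) (s : seq I) (F : I -> R) :
  mod1 (\sum_(i <- s) F i) = \sum_(i <- s) mod1 (F i).
Proof.
elim: s => [|i s IH]; first by rewrite !big_nil mod1_0.
by rewrite !big_cons mod1D IH.
Qed.

Lemma mod1Mz (R : realType) (n : int) (x : R) : mod1 (n%:~R * x) = mod1 x *~ n.
Proof.
have nat_case (m : nat) : mod1 (m%:R * x) = mod1 x *+ m.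
  elim: m => [|m IH]; first by rewrite mul0r mod1_0.
  by rewrite -natr1 mulrDl mul1r mod1D IH mulrSr.
case: n => m; first exact: nat_case.
by rewrite NegzE mulrNz mulNr mod1N nat_case mulrNz.
Qed.

Lemma mod1_eq (R : realType) (x y : R) :
  mod1 x = mod1 y <-> x - y \is a Num.int.
Proof.
have h : (x - y \is a Num.int) = (mod1 x == mod1 y :> {ideal_quot (@Num.int_num_subdef R : {pred R})}).
  exact: (Quotient.idealrBE (@Num.int_num_subdef R : {pred R}) x y).
by rewrite h; split=> [->|/eqP].
Qed.

Lemma mod1_eq0 (R : realType) (x : R) : mod1 x = 0 <-> x \is a Num.int.
Proof. by rewrite -mod1_0 mod1_eq subr0. Qed.

Lemma mod1_surj (R : realType) (t : RmodZ R) : exists2 x : R, 0 <= x < 1 & mod1 x = t.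
Proof.
pose y : R := repr (t : {ideal_quot (@Num.int_num_subdef R : {pred R})}).
have yt : mod1 y = t by exact: reprK.
exists (y - (Num.floor y)%:~R).
  have /andP[h1 h2] := floor_itv y; rewrite subr_ge0 h1 /= ltrBlDr addrC.
  by rewrite -intrD1.
rewrite -yt; apply/mod1_eq; rewrite addrAC subrr add0r rpredN.
by apply/intrP; eexists.
Qed.

Lemma open_mod1 (R : realType) (A : set (RmodZ R)) :
  open A = open (@mod1 R @^-1` A).
Proof. by []. Qed.

Lemma norm_lt1_int (R : realType) (x : R) : x \is a Num.int -> `|x| < 1 -> x = 0.
Proof.
move=> /intrP[m ->]; rewrite -intr_norm -[X in _ < X]/(1%:~R) ltr_int => m1.
by rewrite (_ : m = 0)//; lia.
Qed.

Definition l1norm (R : realType) (G : groupType) (f : ZGamma G) : R :=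
  \sum_(g <- finsupp f) `|(f g)%:~R|.
Arguments l1norm R {G} f.

Lemma l1norm_ge0 (R : realType) (G : groupType) (f : ZGamma G) :
  0 <= l1norm R f.
Proof. exact: sumr_ge0. Qed.

Lemma zconv_bound (R : realType) (G : groupType) (f : ZGamma G) (y : G -> R)
    (x : G) (d : R) :
  (forall g, g \in finsupp f -> `|y (g^-1 * x)%g| <= d) ->
  `|zconv f y x| <= l1norm R f * d.
Proof.
move=> yd; rewrite /l1norm mulr_suml; apply: le_trans (ler_norm_sum _ _ _) _.
rewrite !big_seq; apply: ler_sum => g gf; rewrite normrM ler_wpM2l//.
exact: yd.
Qed.

Lemma zconvB (R : nzRingType) (G : groupType) (f : ZGamma G) (y z : G -> R)
  (x : G) : zconv f (fun u => y u - z u) x = zconv f y x - zconv f z x.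
Proof.
rewrite /zconv -sumrB; apply: eq_bigr => g _; exact: mulrBr.
Qed.

Definition lifts (R : realType) (G : groupType) (f : ZGamma G) : set (G -> R) :=
  [set y | forall x, zconv f y x \is a Num.int].
Arguments lifts R {G} f.

Lemma lifts_X_set (R : realType) (G : groupType) (f : ZGamma G) (y : G -> R) :
  lifts R f y <-> X_set R f (fun x => mod1 (y x)).
Proof.
have E x : \sum_(g <- finsupp f) mod1 (y (g^-1 * x)%g) *~ f g = mod1 (zconv f y x).
  by rewrite mod1_sum; apply: eq_bigr => g _; rewrite mod1Mz.
by split=> yf x; have := yf x; rewrite /= E mod1_eq0.
Qed.

Definition toX (R : realType) (G : groupType) (f : ZGamma G) (y : G -> R)
    (yf : lifts R f y) : X_ R f :=
  SigSub (mem_set (proj1 (lifts_X_set f y) yf)).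

Definition is_lift (R : realType) (G : groupType) (f : ZGamma G) (h : X_ R f)
    (y : G -> R) := forall x, mod1 (y x) = \val h x.

Lemma is_lift_lifts (R : realType) (G : groupType) (f : ZGamma G) (h : X_ R f)
    (y : G -> R) : is_lift h y -> lifts R f y.
Proof.
move=> hy; apply/lifts_X_set; have := set_mem (valP h).
by congr (X_set R f _); apply/funext => x; rewrite hy.
Qed.

Lemma exists_lift (R : realType) (G : groupType) (f : ZGamma G) (h : X_ R f) :
  exists2 y : G -> R, is_lift h y & forall x, 0 <= y x < 1.
Proof.
have [x|y yP] := @choice _ _ (fun x y => 0 <= y < 1 /\ mod1 y = \val h x).
  by have [y y01 yx] := mod1_surj (\val h x); exists y.
by exists y => x; have [] := yP x.
Qed.

Lemma toX_lift (R : realType) (G : groupType) (f : ZGamma G) (h : X_ R f)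
    (y : G -> R) (yf : lifts R f y) : is_lift h y -> toX yf = h.
Proof. by move=> hy; apply/val_inj/funext => x; rewrite /= hy. Qed.

Definition box (R : realType) (G : choiceType) (x : G -> R)
    (ed : {fset G} * R) : set (G -> R) :=
  [set y | forall e, e \in ed.1 -> `|y e - x e| < ed.2].

Lemma near_all_seq (T : Type) (I : eqType) (F : set_system T) (s : seq I)
    (P : I -> T -> Prop) : Filter F ->
  (forall i, i \in s -> \forall x \near F, P i x) ->
  \forall x \near F, forall i, i \in s -> P i x.
Proof.
move=> FF; elim: s => [|i s IH] sP; first exact: filterS filterT.
have h1 := sP i (mem_head _ _).
have h2 := IH (fun j js => sP j (mem_behead (s := i :: s) js)).
apply: filterS2 h1 h2 => x Pi Ps j; rewrite inE => /orP[/eqP ->//|].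
exact: Ps.
Qed.

Lemma box_nbhs (R : realType) (G : choiceType) (x : {ptws G -> R})
    (ed : {fset G} * R) : 0 < ed.2 -> nbhs x (box x ed).
Proof.
move=> d0; apply: (@near_all_seq _ _ (nbhs x) ed.1
  (fun e (y : {ptws G -> R}) => `|y e - x e| < ed.2)) => e _.
have h : nbhs x ((fun y : {ptws G -> R} => y e) @^-1` ball (x e) ed.2).
  exact: (@proj_continuous G (fun=> R) e x _ (nbhsx_ballx (x e) _ d0)).
apply: (filterS _ h) => y yb; rewrite distrC; exact: yb.
Qed.

(** Tails for growing [E] and shrinking [d]; they generate the filter along which compactness makes
    a local choice of (E, d) uniform. *)
Definition finer (R : realType) (G : choiceType) (ed : {fset G} * R) :
    set ({fset G} * R) :=
  [set ed' : {fset G} * R | [/\ 0 < ed'.2, {subset ed.1 <= ed'.1} & ed'.2 <= ed.2]].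

Lemma finer_filter (R : realType) (G : choiceType) :
  Filter (filter_from [set ed : {fset G} * R | 0 < ed.2] (@finer R G)).
Proof.
apply: filter_from_filter; first by exists (fset0, 1) => /=.
move=> [E d] [E' d'] /= d0 d'0; exists ((E `|` E')%fset, Num.min d d') => /=.
  by rewrite lt_min d0.
move=> [E'' d''] /= [d''0 sE]; rewrite le_min => /andP[le1 le2]; split; split=> //.
  by move=> e eE; apply: sE; rewrite inE eE.
by move=> e eE; apply: sE; rewrite inE eE orbT.
Qed.

Lemma open_box (R : realType) (G : choiceType) (O : set {ptws G -> RmodZ R})
    (x : G -> R) : open O -> O (fun g => mod1 (x g)) ->
  exists2 ed : {fset G} * R, 0 < ed.2 &
    forall y, box x ed y -> O (fun g => mod1 (y g)).
Proof.
move=> oO Ox.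
pose F := filter_from [set ed : {fset G} * R | 0 < ed.2] (box x).
have FF : Filter F.
  apply: filter_from_filter; first by exists (fset0, 1) => /=.
  move=> [E d] [E' d'] /= d0 d'0; exists ((E `|` E')%fset, Num.min d d') => /=.
    by rewrite lt_min d0.
  move=> y yb; split=> e eE /=.
    by have := yb e; rewrite /= inE eE => /(_ isT); rewrite lt_min => /andP[].
  by have := yb e; rewrite /= inE eE orbT => /(_ isT); rewrite lt_min => /andP[].
pose q (y : G -> R) : {ptws G -> RmodZ R} := fun g => mod1 (y g).
have qF : q @ F --> q x.
  apply/cvg_sup => t A [V [[W oW <-] Wxt] VA].
  apply: (filterS VA).
  have : nbhs (x t) (@mod1 R @^-1` W).
    by apply: open_nbhs_nbhs; split=> //; rewrite -open_mod1.
  move=> /nbhs_ballP[d /= d0 dW]; exists ([fset t]%fset, d) => //= y yb.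
  by apply: dW; rewrite /ball /= distrC; apply: yb; rewrite /= inE.
have : nbhs (q x) O by exact: open_nbhs_nbhs.
by move=> /qF [ed ed0 edO]; exists ed.
Qed.

Lemma lifts_closed_box (R : realType) (G : groupType) (f : ZGamma G)
    (x : G -> R) : ~ lifts R f x ->
  exists2 ed : {fset G} * R, 0 < ed.2 & forall y, box x ed y -> ~ lifts R f y.
Proof.
move=> /existsNP[x0]; set r := zconv f x x0 => rint.
have /andP[r1 r2] := floor_itv r; rewrite intrD1 in r2.
have {}r1 : (Num.floor r)%:~R < r.
  rewrite lt_neqAle r1 andbT; apply/negP => /eqP rE.
  by apply: rint; rewrite -rE; apply/intrP; eexists.
pose eta := Num.min (r - (Num.floor r)%:~R) ((Num.floor r)%:~R + 1 - r).
have eta0 : 0 < eta by rewrite lt_min !subr_gt0 r1.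
have Q0 := l1norm_ge0 R f.
exists ([fset (g^-1 * x0)%g | g in finsupp f]%fset, eta / (l1norm R f + 1)) => /=.
  by rewrite divr_gt0// ltr_wpDl.
move=> y yb yl.
have : `|zconv f (fun u => y u - x u) x0| <= l1norm R f * (eta / (l1norm R f + 1)).
  apply: zconv_bound => g gf; apply/ltW/yb.
  by apply/imfsetP; exists g.
rewrite zconvB -/r; have /intrP[m ->] := yl x0 => h.
have {h} : `|m%:~R - r| < eta.
  apply: le_lt_trans h _; rewrite mulrCA gtr_pMr// ltr_pdivrMr ?ltr_wpDl//.
  by rewrite mul1r ltrDl.
rewrite lt_min => /andP[]; rewrite !ltr_norml => /andP[h1 h2] /andP[h3 h4].
have : (Num.floor r)%:~R < (m%:~R : R) by lra.
have : (m%:~R : R) < ((Num.floor r) + 1)%:~R by rewrite intrD1; lra.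
by rewrite !ltr_int ltzD1 leNgt => /negP.
Qed.

(** A Lebesgue number, obtained from compactness of the cube [0,1]^G of lifts instead of X_f itself.
    Lifts of points of X_f form a closed set, so the required property holds vacuously near every
    other point of the cube. *)
Lemma cover_lebesgue_number (R : realType) (G : groupType) (f : ZGamma G)
    (U : set (set (X_ R f))) :
  U `<=` open -> \bigcup_(A in U) A = setT ->
  exists (E : {fset G}) (d : R), 0 < d /\ forall h : X_ R f,
    exists2 A, U A & forall h' : X_ R f,
      (forall e, e \in E ->
         exists2 b : R, `|b| < d & \val h' e - \val h e = mod1 b) -> A h'.
Proof.
move=> Uo Ucov.
pose F := filter_from [set ed : {fset G} * R | 0 < ed.2] (@finer R G).
have FF : Filter F by exact: finer_filter.
pose K : set {ptws G -> R} := [set x | forall g, `[0 : R, 1]%classic (x g)].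
have Kc : compact K.
  exact: (@tychonoff G (fun=> R) (fun=> `[0 : R, 1]%classic) (fun=> @segment_compact R 0 1)).
pose P (ed : {fset G} * R) (x : {ptws G -> R}) := lifts R f x ->
  0 < ed.2 /\ exists2 A, U A & forall y (yf : lifts R f y), box x ed y -> A (toX yf).
have /compact_near_coveringP/(_ _ F P FF) := Kc.
case.
  move=> x _; have [xf|xf] := pselect (lifts R f x).
    have : (\bigcup_(A in U) A) (toX xf) by rewrite Ucov.
    move=> [A UA Ax]; have [W oW WA] := Uo A UA.
    have : W (fun g => mod1 (x g)) by rewrite -WA in Ax.
    move=> /(open_box oW)[[E d] /= d0 bW].
    (* One half is spent on moving the centre from [x] to [x'], the other on the box around [x']. *)
    have d2 : 0 < d / 2 by rewrite divr_gt0.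
    exists (box x (E, d / 2), finer (E, d / 2)).
      by split; [exact: box_nbhs | exists (E, d / 2)].
    move=> [x' [E' d']] /= [x'x [d'0 EE' d'd]] x'f; split=> //.
    exists A => // y yf yx'; rewrite -WA; apply: bW => e eE.
    have := x'x e eE; have := yx' e (EE' e eE); rewrite /= => h1 h2.
    rewrite -(subrKA (x' e)); apply: le_lt_trans (ler_normD _ _) _.
    by rewrite [ltRHS](splitr d) ltrD// (lt_le_trans h1).
  have [ed ed0 bN] := lifts_closed_box xf.
  exists (box x ed, setT) => /=; first by split; [exact: box_nbhs|exact: filterT].
  by move=> [x' i] /= [/bN x'N _].
move=> [E d] /= d0 KP; exists E, d; split=> // h.
have [x xh x01] := exists_lift h.
have Kx : K x.
  by move=> g; rewrite /= in_itv/=; have /andP[-> /ltW ->] := x01 g.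
have xf := is_lift_lifts xh.
have fin : finer (E, d) (E, d) by split.
have [_ [A UA AP]] : 0 < d /\ exists2 A, U A & forall y (yf : lifts R f y), box x (E, d) y -> A (toX yf)
  by exact: KP fin x Kx xf.
exists A => // h' h'h.
have [z zh' _] := exists_lift h'.
have [e|b bP] := @choice _ _ (fun e b => e \in E ->
    `|b| < d /\ \val h' e - \val h e = mod1 b).
  have [eE|eE] := boolP (e \in E); last by exists 0.
  by have [b b1 b2] := h'h e eE; exists b.
(* Closeness is known only on [E]: there the lift of [h'] is taken next to [x], elsewhere any lift
   will do. *)
pose y e := if e \in E then x e + b e else z e.
have yh' : is_lift h' y.
  move=> e; rewrite /y; case: ifPn => // eE; have [_ eb] := bP e eE.
  by rewrite mod1D -eb xh addrC subrK.
rewrite -(toX_lift (is_lift_lifts yh') yh'); apply: AP => e /= eE.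
by rewrite /y eE addrC addKr; have [] := bP e eE.
Qed.

(** * Covers *)

(** The arc of radius 1/N about j/N, read at the coordinate 1; the action moves any other coordinate
    there. Points of one arc have lifts less than 2/N apart. *)
Definition coord_arc (R : realType) (G : groupType) (f : ZGamma G) (N j : nat) :
    set (X_ R f) :=
  [set h | exists2 a : R, (j%:R - 1) / N%:R < a < (j%:R + 1) / N%:R &
                          \val h 1%g = mod1 a].
Arguments coord_arc R {G} f N j.

Definition arcs (R : realType) (G : groupType) (f : ZGamma G) (N : nat) :
  set (set (X_ R f)) := [set coord_arc R f N j | j in `I_N].
Arguments arcs R {G} f N.

Lemma open_mod1_itv (R : realType) (a b : R) :
  open [set mod1 x | x in `]a, b[%classic].
Proof.
rewrite open_mod1 openE => x [y]; rewrite /= in_itv/= => /andP[ay yb] yx.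
have d0 : 0 < Num.min (y - a) (b - y) by rewrite lt_min !subr_gt0 ay.
apply/nbhs_ballP; exists (Num.min (y - a) (b - y)) => //= z.
rewrite /ball /= lt_min => /andP[h1 h2].
exists (y + (z - x)); last by rewrite mod1D yx -mod1D addrC subrK.
rewrite /= in_itv/=; move: h1 h2; rewrite !ltr_norml => /andP[h1 h2] /andP[h3 h4].
by apply/andP; split; lra.
Qed.

Lemma arcs_finite_open_cover (R : realType) (G : groupType) (f : ZGamma G)
    (N : nat) : (0 < N)%N -> finite_open_cover (arcs R f N).
Proof.
move=> N0; have NR : (0 : R) < N%:R by rewrite ltr0n.
split.
- exact/finite_image/finite_II.
- move=> _ [j _ <-].
  pose I := [set @mod1 R x | x in `](j%:R - 1) / N%:R, (j%:R + 1) / N%:R[%classic].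
  have -> : coord_arc R f N j = [set h | I (\val h 1%g)].
    apply/seteqP; split=> h /=; first by move=> [a aI ->]; exists a => //=; rewrite in_itv.
    by move=> [a /=]; rewrite in_itv/= => aI aE; exists a.
  exists [set p : {ptws G -> RmodZ R} | I (p 1%g)] => //.
  have pc := @proj_continuous G (fun=> RmodZ R) 1%g.
  have cP := @continuousP {ptws G -> RmodZ R} (RmodZ R) (fun p => p 1%g).
  by apply: (proj1 cP pc I); exact: open_mod1_itv.
- apply/seteqP; split=> // h _.
  have [x /andP[x0 x1] xh] := mod1_surj (\val h 1%g).
  have xN0 : 0 <= x * N%:R by rewrite mulr_ge0// ltW.
  have xN : (Num.truncn (x * N%:R))%:R <= x * N%:R < (Num.truncn (x * N%:R)).+1%:R.
    exact: truncn_itv.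
  exists (coord_arc R f N (Num.truncn (x * N%:R))).
    exists (Num.truncn (x * N%:R)) => //=.
    rewrite -(ltr_nat R); case/andP: xN => xN _; apply: le_lt_trans xN _.
    by rewrite -[ltRHS]mul1r ltr_pM2r.
  exists x => //; rewrite ltr_pdivrMr// ltr_pdivlMr//.
  case/andP: xN => h1; rewrite -natr1 => h2; rewrite h2 andbT.
  by apply: lt_le_trans h1; rewrite ltrBlDr ltrDl.
Qed.

Lemma coded_subcover (X : Type) (V : set (set X)) (T : finType) (D : {set T})
    (code : X -> T) : (forall x, code x \in D) ->
  (forall t, t \in D -> exists2 W, V W & forall x, code x = t -> W x) ->
  exists2 W, subcovers V W & (#|` W| <= #|D|)%N.
Proof.
move=> cD DW; have [t|W WP] := @choice _ _ (fun t W => t \in D ->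
  V W /\ forall x, code x = t -> W x).
  have [tD|tD] := boolP (t \in D); last by exists set0.
  by have [W VW Wt] := DW t tD; exists W.
exists [fset W t | t in D]%fset; last first.
  by apply: leq_trans (leq_imfset_card _ _ _) _; rewrite /= -cardE.
split.
  by move=> _ /= /imfsetP[t /= tD ->]; have [] := WP t tD.
apply/seteqP; split=> // x _; exists (W (code x)).
  by apply/imfsetP; exists (code x) => //=; exact: cD.
by have [_] := WP _ (cD x); apply.
Qed.

Lemma cover_number_le (R : realType) (X : Type) (V : set (set X))
    (W : {fset set X}) : subcovers V W -> cover_number R V <= #|` W|%:R.
Proof.
move=> VW; apply: ge_inf; last by exists W.
by exists 0 => _ [W' _ <-].
Qed.

Lemma cover_number_ge (R : realType) (X : Type) (V : set (set X)) (c : R)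
    (W : {fset set X}) : subcovers V W ->
  (forall W', subcovers V W' -> c <= #|` W'|%:R) -> c <= cover_number R V.
Proof.
move=> VW h; apply: lb_le_inf; first by exists #|` W|%:R, W.
by move=> _ [W' VW' <-]; exact: h.
Qed.

(** Guards the infimum in [cover_number] against its default value on the empty set. *)
Lemma join_subcovers_neq0 (G : choiceType) (X : Type) (a : G -> X -> X)
    (F : {fset G}) (U : set (set X)) :
  finite_set U -> \bigcup_(A in U) A = setT ->
  exists W, subcovers (cover_join a F U) W.
Proof.
move=> /finite_fsetP[Uf UE] Ucov.
have [p|c cP] := @choice _ _ (fun (p : G * X) A => U A /\ A (a p.1 p.2)).
  have : (\bigcup_(A in U) A) (a p.1 p.2) by rewrite Ucov.
  by move=> [A UA Ap]; exists A.
have cU p : c p \in Uf by have [] := cP p; rewrite UE.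
pose code (x : X) : {ffun F -> Uf} := [ffun g => [` cU (val g, x)]%fset].
have [//| |W WV _] := @coded_subcover X (cover_join a F U) _ [set: {ffun F -> Uf}]%SET code.
  move=> t _; exists (\bigcap_(g in [set` F]) (a g @^-1`
      (if insub g is Some g' then val (t g') else setT))).
    exists (fun g => if insub g is Some g' then val (t g') else setT) => //= g gF.
    by rewrite insubT /=; rewrite UE; exact: valP.
  move=> x xt g /= gF; rewrite insubT /= -xt ffunE /=.
  by have [] := cP (g, x).
by exists W.
Qed.

(** * Lower bound for the cover numbers *)

Lemma exists_choice (X Y : Type) (P : X -> Y -> Prop) :
  (forall x, exists y, P x y) -> exists f : X -> Y, forall x, P x (f x).
Proof. by move=> /choice[f fP]; exists f. Qed.

Lemma labelled_vectors_count (R : realFieldType) (I J S : finType)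
    (lab : J -> S) (v : J -> {ffun I -> int}) (L : nat) (t : R) :
    0 < t -> t < 1 -> injective (fun j => (lab j, v j)) ->
    (forall j, \sum_i `|v j i|%N <= L)%N ->
  #|J|%:R * t ^+ L <= #|S|%:R * (2 / (1 - t)) ^+ #|I|.
Proof.
move=> t0 t1 inj vL.
have -> : #|J| = (\sum_(s : S) #|[set j | lab j == s]%SET|)%N.
  rewrite -sum1_card (partition_big lab predT)//=.
  by apply: eq_bigr => s _; rewrite sum1dep_card.
rewrite natr_sum mulr_suml -sumr_const mulr_suml; apply: ler_sum => s _.
rewrite mul1r -card_sig.
pose J' := {j : J | j \in [set j | lab j == s]%SET}.
apply: (@integer_vectors_count R I J' (fun j => v (val j))) => //.
move=> [j js] [j' j's] /= vv; apply/val_inj/inj => /=.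
by move: js j's; rewrite !inE vv => /eqP -> /eqP ->.
Qed.

Lemma sum_norm_subset (R : numDomainType) (T : eqType) (N s : seq T)
    (y : T -> R) : uniq N -> uniq s -> (forall u, u \notin s -> y u = 0) ->
  \sum_(u <- N) `|y u| <= \sum_(u <- s) `|y u|.
Proof.
move=> uN us ys.
have -> : \sum_(u <- N) `|y u| =
    \sum_(w <- s) \sum_(u <- N) (u == w)%:R * `|y u|.
  rewrite exchange_big /=; apply: eq_bigr => u _.
  under eq_bigr do rewrite eq_sym.
  rewrite (sum_delta _ (fun=> `|y u|))//.
  by case: ifPn => // /ys ->; rewrite normr0.
apply: ler_sum => w _; rewrite (sum_delta _ (fun u => `|y u|))//.
by case: ifP.
Qed.

Lemma l1_zconv_le (R : realType) (G : groupType) (f : ZGamma G) (N s : seq G)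
    (y : G -> R) : uniq N -> uniq s -> (forall u, u \notin s -> y u = 0) ->
  \sum_(x <- N) `|zconv f y x| <= l1norm R f * \sum_(u <- s) `|y u|.
Proof.
move=> uN us ys; rewrite /l1norm mulr_suml.
apply: (@le_trans _ _ (\sum_(x <- N) \sum_(g <- finsupp f)
    `|(f g)%:~R| * `|y (g^-1 * x)%g|)).
  apply: ler_sum => x _; apply: le_trans (ler_norm_sum _ _ _) _.
  by apply: ler_sum => g _; rewrite normrM.
rewrite exchange_big /=; apply: ler_sum => g _.
rewrite -mulr_sumr ler_wpM2l//.
rewrite -(big_map (fun x => g^-1 * x)%g predT (fun u => `|y u|)).
apply: sum_norm_subset => //; rewrite map_inj_uniq//; exact: mulgI.
Qed.

(** Representatives are taken in the half-open parallelepiped A [0,1)^k, so their coordinates are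
    bounded by the l1-norms of the rows of A, however large the determinant is. *)
Lemma coker_reps (R : realType) k (A : 'M[int]_k) : \det A != 0 ->
  exists (T : finType) (z : T -> 'cV[int]_k) (t : T -> 'cV[R]_k),
    [/\ #|T| = `|\det A|%N, (forall i l, 0 <= t i l 0 < 1),
        (forall i, map_mx intr (z i) = map_mx intr A *m t i) &
        forall i j w, z i - z j = A *m w -> i = j].
Proof.
move=> A0; have [T [c [cardT cE csurj]]] := coker_classes A0.
have [zeta zetaP] := choice csurj.
pose AR : 'M[R]_k := map_mx intr A.
have ARu : AR \in unitmx by rewrite unitmxE unitfE det_map_mx intr_eq0.
pose s i : 'cV[R]_k := invmx AR *m map_mx intr (zeta i).
pose w i : 'cV[int]_k := map_mx Num.floor (s i).
exists T, (fun i => zeta i - A *m w i), (fun i => s i - map_mx intr (w i)).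
split=> //.
- move=> i l; rewrite /w; move: (s i) => x; rewrite !mxE.
  have /andP[h1 h2] := floor_itv (x l 0).
  by rewrite subr_ge0 h1 ltrBlDr addrC -intrD1.
- move=> i; rewrite mulmxBr /s mulKVmx// map_mxB map_mxM//.
- move=> i j u uE; rewrite -(zetaP i) -(zetaP j); apply/cE.
  exists (u + (w i - w j)); rewrite mulmxDr -uE mulmxBr.
  move: (A *m w i) (A *m w j) => a b.
  by apply/matrixP => p q; rewrite !mxE; ring.
Qed.

(** At the remaining points of KF the value of f y depends only on y restricted to F. *)
Definition inner_bd (G : groupType) (f : ZGamma G) (F : {fset G}) : {fset G} :=
  [fset x in zcover f F | ~~ all (fun g => (g^-1 * x)%g \in F) (finsupp f)]%fset.

Lemma int_norm_le_sqr (n : int) : (`|n| <= `|n| ^ 2)%N.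
Proof. by case: `|n|%N => // m; rewrite expnS leq_pmulr// expn_gt0. Qed.

Lemma zconv_intr (R : nzRingType) (G : groupType) (f : ZGamma G) (y : G -> int)
    (x : G) : (zconv f y x)%:~R = zconv f (fun u => (y u)%:~R : R) x.
Proof.
rewrite /zconv rmorph_sum; apply: eq_bigr => g _ /=.
by rewrite rmorphM /= intz.
Qed.

(* Bounded representatives zeta of Z^k modulo A Z^k give points f^-1 zeta of
   X_f. Two such points in the same element of the cover differ on F by an
   integral vector plus a vector that f maps to 0 off the boundary, so that the
   class of zeta is recovered from the element and an integral vector of small
   norm on the boundary. *)
Lemma max_minor_le_subcover (R : realType) (G : groupType) (f : ZGamma G) :
  solvable R f -> exists N B : nat, (0 < N)%N /\
  forall (F : {fset G}) (W : {fset set (X_ R f)}) (t : R),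
    subcovers (cover_join (alpha R f) F (arcs R f N)) W -> 0 < t -> t < 1 ->
  (max_minor f F)%:R * t ^+ (B * #|` F|) <=
    #|` W|%:R * (2 / (1 - t)) ^+ #|` inner_bd f F|.
Proof.
move=> [C C0 fC]; pose Q := l1norm R f; have Q0 : 0 <= Q := l1norm_ge0 R f.
(* Chosen so that f maps a difference of two lifts from common arcs, of size at most 2/N, to values
   of absolute value below 1. *)
pose N := (Num.truncn (2 * Q)).+1.
have NR : (0 : R) < N%:R by rewrite ltr0n.
have QN : Q * (2 / N%:R) < 1.
  by rewrite mulrA ltr_pdivrMr// mul1r mulrC truncnS_gt.
(* The two summands bound, per point of F, the l1-norms of zeta and of f n, where n is the integral
   part of f^-1 zeta relative to the arcs. *)
pose B := (Num.truncn (Q + Q * (2 * (C * Q ^+ 2) + 2))).+1.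
exists N, B; split=> // F W t Wcov t0 t1.
set k := #|` F|; have uF : uniq F := fset_uniq F.
have [->|M0] := eqVneq (max_minor f F) 0%N.
  rewrite mul0r mulr_ge0// exprn_ge0// divr_ge0// subr_ge0 ltW//.
have [x xN xM] : exists2 x : 'I_k -> G, (forall i, x i \in zcover f F) &
    max_minor f F = `|\det (zmx int f x (tnth (in_tuple F)))|%N.
  have T0 : (0 < #|{ffun 'I_k -> 'I_(size (zcover f F))}|)%N.
    rewrite lt0n; apply: contraNN M0 => /eqP/card0_eq h.
    by rewrite /max_minor big1// => r _; have := h r; rewrite inE.
  have [r rE] := bigop.eq_bigmax (fun r : {ffun 'I_k -> 'I_(size (zcover f F))} =>
    `|\det (zmx int f (fun i => tnth (in_tuple (zcover f F)) (r i))
             (tnth (in_tuple F)))|%N) T0.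
  by exists (fun i => tnth (in_tuple (zcover f F)) (r i)) => // i; exact: mem_tnth.
set A := zmx int f x _ in xM.
have A0 : \det A != 0 by move: M0; rewrite xM absz_eq0.
have xinj : injective x.
  move=> i j xij; apply/eqP; apply: contraNT A0 => ij.
  by apply/eqP/(determinant_alternate ij) => l; rewrite !mxE xij.
have [T [z [s [cardT s01 zs zinj]]]] := coker_reps R A0.
rewrite xM -cardT.
pose zi (tau : T) (u : G) : int := \sum_i (x i == u)%:R * z tau i 0.
have zix tau i : zi tau (x i) = z tau i 0.
  rewrite /zi (bigD1 i)//= eqxx mul1r big1 ?addr0// => j ji.
  by rewrite (inj_eq xinj) (negbTE ji) mul0r.
pose zr (tau : T) (u : G) : R := (zi tau u)%:~R.
pose X := [seq x i | i : 'I_k].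
have uX : uniq X by rewrite map_inj_uniq// enum_uniq.
have ziX tau u : u \notin X -> zi tau u = 0.
  move=> uX'; rewrite /zi big1// => i _; case: eqP => [xu|_]; last by rewrite mul0r.
  by case/negP: uX'; rewrite -xu; apply: map_f; rewrite mem_enum.
have zrX tau u : u \notin X -> zr tau u = 0 by move=> /ziX; rewrite /zr => ->.
have zbound tau i : `|zr tau (x i)| <= Q.
  rewrite /zr zix; have -> : (z tau i 0)%:~R = (map_mx intr (z tau)) i 0 :> R.
    by rewrite mxE.
  have [y yE] := vec_fun (s tau) uF.
  pose y' u := if u \in F then y u else 0.
  have -> : map_mx intr (z tau) i 0 = zconv f y' (x i) :> R.
    rewrite zs mxE (zconvE (S := F))//; last first.
      by move=> g _ /negbTE gF; rewrite /y' gF.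
    rewrite (big_tnth _ _ F); apply: eq_bigr => j _.
    rewrite !mxE /y' (mem_tnth j (in_tuple F)) -yE.
    by rewrite /zrow intz.
  rewrite -[Q]mulr1; apply: zconv_bound => g _; rewrite /y'.
  case: ifPn => [gF|_]; last by rewrite normr0.
  have gi : (index (g^-1 * x i)%g F < size F)%N by rewrite index_mem.
  have := yE (Ordinal gi); rewrite (tnth_nth 1%g) /= nth_index// => <-.
  by have /andP[h1 /ltW h2] := s01 tau (Ordinal gi); rewrite ger0_norm.
have [D DP] : exists D : T -> G -> R, forall tau, zconv f (D tau) =1 zr tau /\
    forall S, uniq S -> sqsum S (D tau) <= C * (Q ^+ 2 * k%:R).
  apply: (@exists_choice _ _ (fun tau D => zconv f D =1 zr tau /\
    forall S, uniq S -> sqsum S D <= C * (Q ^+ 2 * k%:R))) => tau.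
  have [D D1 D2] := fC X (zr tau) uX (zrX tau); exists D; split=> // S uS.
  apply: le_trans (D2 S uS) _; rewrite ler_pM2l//.
  rewrite /sqsum big_image /=.
  apply: (@le_trans _ _ (\sum_(i < k) Q ^+ 2)).
    apply: ler_sum => i _; rewrite -[leLHS]real_normK ?num_real// lerXn2r ?nnegrE//.
  by rewrite sumr_const card_ord mulr_natr.
have Dl tau : lifts R f (D tau).
  by move=> u; rewrite (proj1 (DP tau)); apply/intrP; exists (zi tau u).
pose h tau := toX (Dl tau).
have [w wP] : exists w : T -> W, forall tau, val (w tau) (h tau).
  apply: (@exists_choice _ _ (fun tau (w : W) => val w (h tau))) => tau.
  have : (\bigcup_(S in [set` W]) S) (h tau) by rewrite (proj2 Wcov).
  by move=> [S SW Sh]; exists [` SW]%fset.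
have [gam gamP] : exists gam : W -> G -> nat, forall (S : W) h0 g, val S h0 -> g \in F ->
    (gam S g < N)%N /\ coord_arc R f N (gam S g) (alpha R f g h0).
  apply: (@exists_choice _ _ (fun (S : W) gam => forall h0 g, val S h0 -> g \in F ->
    (gam g < N)%N /\ coord_arc R f N (gam g) (alpha R f g h0))) => S.
  have [c cU SE] := proj1 Wcov _ (valP S).
  have [g|gam gP] := @exists_choice _ _ (fun g j => g \in F ->
      (j < N)%N /\ coord_arc R f N j = c g).
    have [gF|gF] := boolP (g \in F); last by exists 0%N.
    by have [j jN jE] := cU g gF; exists j.
  exists gam => h0 g; rewrite -SE => Sh gF; have [gN gE] := gP g gF.
  by split=> //; rewrite gE; exact: Sh.
have [a aP] : exists a : T -> G -> R, forall tau g, g \in F ->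
    [/\ ((gam (w tau) g)%:R - 1) / N%:R < a tau g < ((gam (w tau) g)%:R + 1) / N%:R,
        `|a tau g| <= 1 & D tau g - a tau g \is a Num.int].
  apply: (@exists_choice _ _ (fun tau a => forall g, g \in F ->
    [/\ ((gam (w tau) g)%:R - 1) / N%:R < a g < ((gam (w tau) g)%:R + 1) / N%:R,
        `|a g| <= 1 & D tau g - a g \is a Num.int])) => tau.
  apply: (@exists_choice _ _ (fun g a => g \in F ->
    [/\ ((gam (w tau) g)%:R - 1) / N%:R < a < ((gam (w tau) g)%:R + 1) / N%:R,
        `|a| <= 1 & D tau g - a \is a Num.int])) => g.
  have [gF|gF] := boolP (g \in F); last by exists 0.
  have [gN [b bI bE]] := gamP (w tau) (h tau) g (wP tau) gF.
  exists b => _; split=> //.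
    case/andP: bI; rewrite ltr_pdivrMr// ltr_pdivlMr// => b1 b2.
    have gN' : (gam (w tau) g)%:R + 1 <= N%:R :> R by rewrite natr1 ler_nat.
    have g0 : (0 : R) <= (gam (w tau) g)%:R by [].
    have N1 : (1 : R) <= N%:R by rewrite ler1n.
    rewrite -(ler_pM2r NR) mul1r -[X in _ * X](ger0_norm (ltW NR)) -normrM.
    by rewrite ler_norml; apply/andP; split; lra.
  by apply/mod1_eq; rewrite -bE /= mul1g.
have [n nP] : exists n : T -> G -> int, forall tau g,
    (g \in F -> D tau g - a tau g = (n tau g)%:~R) /\ (g \notin F -> n tau g = 0).
  apply: (@exists_choice _ _ (fun tau n => forall g,
    (g \in F -> D tau g - a tau g = (n g)%:~R) /\ (g \notin F -> n g = 0))) => tau.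
  apply: (@exists_choice _ _ (fun g (m : int) =>
    (g \in F -> D tau g - a tau g = m%:~R) /\ (g \notin F -> m = 0))) => g.
  have [gF|gF] := boolP (g \in F); last by exists 0.
  by have [_ _ /intrP[m mE]] := aP tau g gF; exists m.
have n0 tau g : g \notin F -> n tau g = 0 by move=> /(proj2 (nP tau g)).
pose v tau : {ffun inner_bd f F -> int} :=
  [ffun u => zi tau (val u) - zconv f (n tau) (val u)].
(* Equal labels and equal defects force zeta - zeta' = f (n - n') on the selected rows, that is,
   equality of the classes modulo A. *)
have inj : injective (fun tau => (w tau, v tau)).
  move=> tau tau' [wE vE].
  pose dn u := n tau u - n tau' u.
  apply: (zinj _ _ (\col_j dn (tnth (in_tuple F) j))).
  apply/colP => i.
  have -> : (z tau - z tau') i 0 = z tau i 0 - z tau' i 0 by rewrite !mxE.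
  rewrite -!zix.
  have -> : (A *m \col_j dn (tnth (in_tuple F) j)) i 0 = zconv f dn (x i).
    rewrite mxE (zconvE (S := F))//; last first.
      by move=> g _ gF; rewrite /dn !n0.
    by rewrite (big_tnth _ _ F); apply: eq_bigr => j _; rewrite !mxE.
  have [xbd|] := boolP (x i \in inner_bd f F).
    have := congr1 (fun v : {ffun inner_bd f F -> int} => v [` xbd]%fset) vE.
    rewrite !ffunE /= zconvB => vx.
    rewrite -[zi tau (x i)](subrK (zconv f (n tau) (x i))) vx; ring.
  rewrite !inE /= xN /= negbK => /allP xin.
  (* Off the boundary the difference of the two sides is f applied to a - a', with arguments in F;
     it is integral and smaller than 1, hence 0. *)
  apply/eqP; rewrite -(inj_eq (@intr_inj R)) zconv_intr rmorphB /= -/(zr _ _) -/(zr _ _).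
  rewrite -(proj1 (DP tau)) -(proj1 (DP tau')) -zconvB -subr_eq0 -zconvB; apply/eqP.
  apply: norm_lt1_int.
    rewrite !zconvB !(proj1 (DP _)) -zconv_intr -!rmorphB; apply/intrP.
    by eexists.
  apply: le_lt_trans QN; apply: zconv_bound => g gf.
  have gF := xin g gf.
  have [/andP[b1 b2] _ _] := aP tau _ gF; have [/andP[b3 b4] _ _] := aP tau' _ gF.
  have [nE _] := nP tau (g^-1 * x i)%g; have [nE' _] := nP tau' (g^-1 * x i)%g.
  rewrite /dn rmorphB /= -(nE gF) -(nE' gF).
  rewrite -wE in b3 b4; move: b1 b2 b3 b4; set a1 := a tau _; set a2 := a tau' _.
  rewrite !ltr_pdivrMr// !ltr_pdivlMr// => b1 b2 b3 b4.
  have -> : D tau (g^-1 * x i)%g - D tau' (g^-1 * x i)%g -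
    (D tau (g^-1 * x i)%g - a1 - (D tau' (g^-1 * x i)%g - a2)) = a1 - a2 by ring.
  rewrite ler_pdivlMr// -[X in _ * X](ger0_norm (ltW NR)) -normrM.
  by rewrite ler_norml; apply/andP; split; lra.
have vL tau : (\sum_u `|v tau u|%N <= B * k)%N.
  rewrite -(ler_nat R) natr_sum natrM.
  (* For integers |n| <= n^2, which turns the l2-bound on [D] into an l1-bound on n = D - a, using
     (D - a)^2 <= 2 D^2 + 2. *)
  have nF : \sum_(u <- F) `|(n tau u)%:~R : R| <= (2 * (C * Q ^+ 2) + 2) * k%:R.
    apply: (@le_trans _ _ (\sum_(u <- F) (2 * D tau u ^+ 2 + 2))).
      rewrite !big_seq; apply: ler_sum => u uF'.
      have [_ a1 _] := aP tau u uF'; have [/(_ uF') nE _] := nP tau u.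
      apply: (@le_trans _ _ ((n tau u)%:~R ^+ 2)).
        rewrite -real_normK ?num_real// -intr_norm -abszE -pmulrn -natrX ler_nat.
        exact: int_norm_le_sqr.
      rewrite -nE.
      have a2 : a tau u ^+ 2 <= 1 by rewrite -real_normK ?num_real// exprn_ile1.
      have := sqr_ge0 (D tau u + a tau u).
      by move: a2; rewrite !expr2; lra.
    rewrite big_split /= -mulr_sumr.
    have -> : \sum_(u <- F) (2 : R) = 2 * k%:R.
      by rewrite big_const_seq count_predT iter_addr_0 mulr_natr.
    rewrite [leRHS]mulrDl lerD2r -mulrA ler_pM2l// -mulrA.
    exact: (proj2 (DP tau)).
  have vle : \sum_(u <- inner_bd f F) `|zconv f (fun u => (n tau u)%:~R : R) u| <=
      Q * \sum_(u <- F) `|(n tau u)%:~R : R|.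
    by apply: l1_zconv_le => // [|u uF']; rewrite ?fset_uniq ?n0.
  have zle : \sum_(u <- inner_bd f F) `|zr tau u| <= Q * k%:R.
    apply: (le_trans (sum_norm_subset (fset_uniq _) uX (zrX tau))).
    rewrite big_image /=; apply: (@le_trans _ _ (\sum_(i < k) Q)).
      exact: ler_sum.
    by rewrite sumr_const card_ord mulr_natr.
  apply: (@le_trans _ _ (\sum_(u <- inner_bd f F)
     (`|zr tau u| + `|zconv f (fun u => (n tau u)%:~R : R) u|))).
    rewrite [leRHS]big_seq_fsetE /=; apply: ler_sum => u _.
    rewrite ffunE pmulrn abszE intr_norm rmorphB /= zconv_intr.
    exact: ler_normB.
  rewrite big_split /=; apply: (le_trans (lerD zle vle)).
  apply: (@le_trans _ _ ((Q + Q * (2 * (C * Q ^+ 2) + 2)) * k%:R)).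
    by rewrite mulrDl lerD2l -mulrA ler_wpM2l.
  by rewrite ler_wpM2r// ltW// truncnS_gt.
have := labelled_vectors_count t0 t1 inj vL.
by rewrite -!cardfE.
Qed.

(** * Upper bound for the cover numbers *)

Lemma coker_code k (A : 'M[int]_k) (M : nat) :
  \det A != 0 -> (`|\det A|%N <= M)%N ->
  exists c : 'cV[int]_k -> 'I_M,
    forall z z', c z = c z' -> exists w, z - z' = A *m w.
Proof.
move=> A0 AM; have [T [c [cardT cE _]]] := coker_classes A0.
have lt z : (enum_rank (c z) < M)%N.
  by apply: leq_trans AM; rewrite -cardT ltn_ord.
exists (fun z => Ordinal (lt z)) => z z' /(congr1 val) /= zz'.
by apply/cE/enum_rank_inj/val_inj.
Qed.

Lemma det_colsub_inj (R : comNzRingType) k n (A : 'M[R]_(k, n))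
    (r : {ffun 'I_k -> 'I_n}) : \det (colsub r A) != 0 -> injective r.
Proof.
move=> A0 i j rij; apply/eqP; apply: contraNT A0 => ij.
rewrite -det_tr; apply/eqP/(determinant_alternate ij) => l.
by rewrite !mxE rij.
Qed.

(** Fixes one ordering for each column set, so that the code records a subset, counted by a binomial
    coefficient, and not an ordered selection. *)
Lemma basis_selection (R : comNzRingType) k n (A : 'M[R]_(k, n))
    (r0 : {ffun 'I_k -> 'I_n}) :
  exists rr : {set 'I_n} -> {ffun 'I_k -> 'I_n}, forall r : {ffun 'I_k -> 'I_n},
    \det (colsub r A) != 0 ->
    \det (colsub (rr [set r i | i : 'I_k]%SET) A) != 0 /\
    [set rr [set r i | i : 'I_k]%SET i | i : 'I_k]%SET = [set r i | i : 'I_k]%SET.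
Proof.
have [J|rr rrP] := @exists_choice {set 'I_n} {ffun 'I_k -> 'I_n} (fun J rJ =>
    (exists2 r : {ffun 'I_k -> 'I_n}, \det (colsub r A) != 0 &
      [set r i | i : 'I_k]%SET = J) ->
    \det (colsub rJ A) != 0 /\ [set rJ i | i : 'I_k]%SET = J).
  have [[r r1 r2]|h] := pselect (exists2 r : {ffun 'I_k -> 'I_n},
      \det (colsub r A) != 0 & [set r i | i : 'I_k]%SET = J).
    by exists r.
  by exists r0 => /h.
by exists rr => r r1; apply: rrP; exists r.
Qed.

(** A vector in the left kernel is a function on F that f* sends to 0, because C contains the
    support of its image. *)
Lemma zmx_row_free (R : realFieldType) (G : groupType) (f : ZGamma G)
    (F C : {fset G}) : bounded_below R (star f) ->
  (forall g u, g \in finsupp (star f) -> u \in F -> (g * u)%g \in C) ->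
  row_free (zmx R f (tnth (in_tuple F)) (tnth (in_tuple C))).
Proof.
move=> [c c0 cP] FC; rewrite -kermx_eq0; apply/rowV0P => v /sub_kermxP vA.
have [y yE] := vec_fun v^T (fset_uniq F).
pose y' u := if u \in F then y u else 0.
have y'F u : u \notin F -> y' u = 0 by rewrite /y' => /negbTE ->.
have yz w : w \in C -> zconv (star f) y' w = 0.
  move=> wC; rewrite (zconvE (S := F)) ?fset_uniq//; last first.
    by move=> g _; exact: y'F.
  have iw : (index w C < size C)%N by rewrite index_mem.
  transitivity ((v *m zmx R f (tnth (in_tuple F)) (tnth (in_tuple C))) 0 (Ordinal iw));
    last by rewrite vA mxE.
  rewrite mxE (big_tnth _ _ F); apply: eq_bigr => i _.
  rewrite !mxE zrow_star /y' (mem_tnth i (in_tuple F)) -yE mxE mulrC.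
  by congr (_ * zrow _ _ _ _); rewrite (tnth_nth w) /= nth_index.
have := cP F C y' (fset_uniq _) (fset_uniq _) y'F FC.
rewrite [X in _ * X](_ : _ = 0); last first.
  by rewrite /sqsum big_seq big1// => w /yz ->; rewrite expr0n.
rewrite mulr0 => le0; apply/rowP => i; rewrite mxE.
have := yE i; rewrite mxE => ->.
have sq0 : sqsum F y' = 0 by apply/eqP; rewrite eq_le le0 sqsum_ge0.
move: sq0; rewrite /sqsum (big_tnth _ _ F) => /eqP.
rewrite psumr_eq0; last by move=> j _; exact: sqr_ge0.
move=> /allP/(_ i); rewrite mem_index_enum => /(_ isT) /=.
by rewrite sqrf_eq0 /y' (mem_tnth i (in_tuple F)) => /eqP.
Qed.

(* Pushing a lift of h|_C in [0,1]^C along the kernel of f[F,C] to a vertex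
   leaves only |F| coordinates that may be fractional. *)
Lemma vertex_point (R : realType) (G : groupType) (f : ZGamma G)
    (F C : {fset G}) : bounded_below R (star f) ->
  (forall g u, g \in finsupp (star f) -> u \in F -> (g * u)%g \in C) ->
  forall h : X_ R f, exists (x y : G -> R)
    (r : {ffun 'I_(size F) -> 'I_(size C)}),
  [/\ is_lift h x, forall u, u \notin C -> y u = 0, forall u, `|y u| <= 1,
    forall u, u \in F -> zconv f y u = 0 &
    \det (colsub r (zmx R f (tnth (in_tuple F)) (tnth (in_tuple C)))) != 0 /\
    forall l, l \notin codom r ->
      x (tnth (in_tuple C) l) + y (tnth (in_tuple C) l) \is a Num.int].
Proof.
move=> fb FC h; have [x xh x01] := exists_lift h.
set A := zmx R f _ _.
pose xv : 'cV[R]_(size C) := \col_l x (tnth (in_tuple C) l).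
have xv01 l : 0 <= xv l 0 <= 1.
  by rewrite mxE; have /andP[-> /ltW ->] := x01 (tnth (in_tuple C) l).
have [v [r [Av v01 rA vr]]] := basic_solution (zmx_row_free fb FC) xv01.
have [y yE] := vec_fun (v - xv) (fset_uniq C).
pose y' u := if u \in C then y u else 0.
have y'E l : y' (tnth (in_tuple C) l) = v l 0 - x (tnth (in_tuple C) l).
  by rewrite /y' (mem_tnth l (in_tuple C)) -yE !mxE.
have y'C u : u \notin C -> y' u = 0 by rewrite /y' => /negbTE ->.
exists x, y', r; split=> //.
- move=> u; have [uC|/y'C ->] := boolP (u \in C); last by rewrite normr0.
  have iu : (index u C < size C)%N by rewrite index_mem.
  have -> : u = tnth (in_tuple C) (Ordinal iu) by rewrite (tnth_nth u) /= nth_index.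
  rewrite y'E; have /andP[h1 h2] := v01 (Ordinal iu).
  have := xv01 (Ordinal iu); rewrite mxE => /andP[h3 h4].
  by rewrite ler_norml; apply/andP; split; lra.
- move=> u uF; rewrite (zconvE (S := C)) ?fset_uniq//; last first.
    by move=> g _; exact: y'C.
  have iu : (index u F < size F)%N by rewrite index_mem.
  transitivity ((A *m (v - xv)) (Ordinal iu) 0);
    last by rewrite mulmxBr Av subrr mxE.
  rewrite mxE (big_tnth _ _ C); apply: eq_bigr => l _.
  rewrite y'E !mxE; congr (zrow _ _ _ _ * _).
  by rewrite (tnth_nth u) /= nth_index.
- split=> // l lr; rewrite y'E addrC subrK.
  have := vr l lr; rewrite !inE => /orP[] /eqP ->; last exact: rpred1.
  exact: rpred0.
Qed.

Lemma zmx_comp_star (G : groupType) (f : ZGamma G) (F C : {fset G})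
    (r : 'I_(size F) -> 'I_(size C)) :
  (`|\det (colsub r (zmx int f (tnth (in_tuple F)) (tnth (in_tuple C))))|
    <= max_minor (star f) F)%N.
Proof.
rewrite -det_tr.
apply: leq_trans (le_max_minor _ (fun i => tnth (in_tuple C) (r i))).
rewrite (_ : _^T = zmx int (star f) (fun i => tnth (in_tuple C) (r i))
  (tnth (in_tuple F)))//.
by apply/matrixP => i j; rewrite !mxE zrow_star.
Qed.

(* A point is coded by J, by the class of its vertex modulo Z^J and by the
   integer parts of f y on the boundary, where y is the displacement to the
   vertex: since f is bounded below, the latter determine y up to a small
   l2-error. *)
Lemma fiber_code (R : realType) (G : groupType) (f : ZGamma G) :
  bounded_below R f -> bounded_below R (star f) ->
  exists (b : nat) (B : R), 0 < B /\ forall (F C : {fset G}),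
    (forall g u, g \in finsupp (star f) -> u \in F -> (g * u)%g \in C) ->
  let bd := (zcover f C `\` F)%fset in
  exists (T : finType) (D : {set T}) (code : X_ R f -> T),
    [/\ #|D| = ('C(#|` C|, #|` F|) * max_minor (star f) F * b ^ #|` bd|)%N,
        forall h, code h \in D &
        forall h h', code h = code h' -> exists2 p : G -> R,
          sqsum C p <= B * #|` bd|%:R &
          forall u, u \in C -> \val h' u - \val h u = mod1 (p u)].
Proof.
move=> [B B0 fB] fsb; pose Q := l1norm R f.
have Q0 : 0 <= Q := l1norm_ge0 R f.
pose b0 := (Num.truncn Q).+1.
exists (b0 + b0).+1, B; split=> // F C FC bd.
pose k := size F; pose n := size C.
have M0 : (0 < max_minor (star f) F)%N.
  by have [] := max_minor_lgram fsb (fset_uniq F).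
set M := max_minor (star f) F.
pose AZ := zmx int f (tnth (in_tuple F)) (tnth (in_tuple C)).
pose A := zmx R f (tnth (in_tuple F)) (tnth (in_tuple C)).
have AAZ : A = map_mx intr AZ by exact: zmx_intr.
have detAZ (r : {ffun 'I_k -> 'I_n}) : \det (colsub r A) = (\det (colsub r AZ))%:~R.
  by rewrite AAZ -det_map_mx map_mxsub.
have [X0 [Y0 XYP]] : exists x y : X_ R f -> G -> R, forall h,
    exists r : {ffun 'I_k -> 'I_n},
    [/\ is_lift h (x h), forall u, u \notin C -> y h u = 0, forall u, `|y h u| <= 1,
    forall u, u \in F -> zconv f (y h) u = 0 &
    \det (colsub r A) != 0 /\ forall l, l \notin codom r ->
      x h (tnth (in_tuple C) l) + y h (tnth (in_tuple C) l) \is a Num.int].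
  have [h|p pP] := @exists_choice (X_ R f) ((G -> R) * (G -> R)) (fun h p =>
    exists r : {ffun 'I_k -> 'I_n},
    [/\ is_lift h p.1, forall u, u \notin C -> p.2 u = 0, forall u, `|p.2 u| <= 1,
    forall u, u \in F -> zconv f p.2 u = 0 &
    \det (colsub r A) != 0 /\ forall l, l \notin codom r ->
      p.1 (tnth (in_tuple C) l) + p.2 (tnth (in_tuple C) l) \is a Num.int]).
    by have [x [y [r rP]]] := vertex_point fsb FC h; exists (x, y), r.
  by exists (fun h => (p h).1), (fun h => (p h).2).
have [rh rhP] := exists_choice XYP.
have l0 : lifts R f (fun=> 0).
  by move=> x; rewrite /zconv big1 ?rpred0// => g _; rewrite mulr0.
have [rr rrP] := basis_selection A (rh (toX l0)).
pose J h := [set rh h i | i : 'I_k]%SET.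
have JP h : \det (colsub (rr (J h)) A) != 0 /\
    [set rr (J h) i | i : 'I_k]%SET = J h.
  by apply: rrP; have [_ _ _ _ []] := rhP h.
pose v h u := X0 h u + Y0 h u.
pose vJ h : 'cV[R]_k := \col_i v h (tnth (in_tuple C) (rr (J h) i)).
have vint h l : l \notin J h -> v h (tnth (in_tuple C) l) \is a Num.int.
  move=> lJ; have [_ _ _ _ [_]] := rhP h; apply.
  by apply: contra lJ => /codomP[i ->]; apply/imsetP; exists i.
have Avint h i : (A *m \col_l v h (tnth (in_tuple C) l)) i 0 \is a Num.int.
  have [xh yC _ yF _] := rhP h.
  have xl := is_lift_lifts xh.
  have -> : (A *m \col_l v h (tnth (in_tuple C) l)) i 0 =
      zconv f (X0 h) (tnth (in_tuple F) i).
    have := yF _ (mem_tnth i (in_tuple F)).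
    rewrite (zconvE (S := C)) ?fset_uniq//; last by move=> g _; exact: yC.
    move=> yz; rewrite (zconvE (S := C)) ?fset_uniq//; last first.
      move=> g gf /negP[]; apply: FC; last exact: (mem_tnth i (in_tuple F)).
      by rewrite finsupp_star invgK.
    rewrite -[RHS]addr0 -[X in _ = _ + X]yz mxE !(big_tnth _ _ C) -big_split /=.
    by apply: eq_bigr => l _; rewrite !mxE mulrDr.
  exact: xl.
have sumJ h (H : 'I_n -> R) : \sum_(l in J h) H l = \sum_i H (rr (J h) i).
  rewrite -{1}(proj2 (JP h)) big_imset //= => i1 i2 _ _.
  exact: (det_colsub_inj (proj1 (JP h))).
(* On F, f sends the vertex to the same values as the lift, which are integers; the coordinates
   outside [J h] are integral and can be subtracted. *)
have AvJ h : exists z : 'cV[int]_k, map_mx intr z = colsub (rr (J h)) A *m vJ h.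
  have [i|z zP] := @exists_choice 'I_k int (fun i m =>
      (colsub (rr (J h)) A *m vJ h) i 0 = m%:~R); last first.
    by exists (\col_i z i); apply/colP => i; rewrite !mxE -zP mxE.
  apply/intrP.
  have -> : (colsub (rr (J h)) A *m vJ h) i 0 =
      (A *m \col_l v h (tnth (in_tuple C) l)) i 0 -
      \sum_(l | l \notin J h) A i l * v h (tnth (in_tuple C) l).
    rewrite [X in _ = X - _]mxE (bigID (mem (J h))) /=.
    rewrite [X in _ = _ + X - _](eq_bigr (fun l =>
      A i l * v h (tnth (in_tuple C) l))); last by move=> l _; rewrite mxE.
    rewrite addrK sumJ mxE.
    by apply: eq_bigr => j _; rewrite !mxE.
  apply: rpredB; first exact: Avint.
  apply: rpred_sum => l lJ; apply: rpredM; last exact: vint.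
  by rewrite AAZ mxE; apply/intrP; eexists.
have [z zP] := exists_choice AvJ.
have [kap kapP] : exists kap : {set 'I_n} -> 'cV[int]_k -> 'I_M, forall J,
    \det (colsub (rr J) AZ) != 0 -> forall z z', kap J z = kap J z' ->
    exists w, z - z' = colsub (rr J) AZ *m w.
  apply: (@exists_choice {set 'I_n} ('cV[int]_k -> 'I_M) (fun J kap =>
    \det (colsub (rr J) AZ) != 0 -> forall z z', kap z = kap z' ->
    exists w, z - z' = colsub (rr J) AZ *m w)) => J1.
  have [d0|d0] := eqVneq (\det (colsub (rr J1) AZ)) 0.
    by exists (fun=> Ordinal M0).
  have [c cP] := coker_code d0 (zmx_comp_star f (rr J1)).
  by exists c.
(* The displacement has entries at most 1, so the integer parts lie between -b0 and b0 and the
   shifted ones in ['I_(b0 + b0).+1]. *)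
pose cell h : {ffun bd -> 'I_(b0 + b0).+1} :=
  [ffun u => inord `|(Num.floor (zconv f (Y0 h) (val u)) + b0%:Z)%R|%N].
have yQ h u : `|zconv f (Y0 h) u| <= Q.
  rewrite -[Q]mulr1; apply: zconv_bound => g _.
  by have [_ _ y1 _ _] := rhP h.
have cellE h (u : bd) :
    (cell h u : nat)%:Z = Num.floor (zconv f (Y0 h) (val u)) + b0%:Z.
  have Qb : Q < b0%:~R by rewrite -pmulrn truncnS_gt.
  have := yQ h (val u); rewrite ler_norml => /andP[h1 h2].
  have f1 : - b0%:Z <= Num.floor (zconv f (Y0 h) (val u)).
    by rewrite floor_ge_int mulrNz; lra.
  have f2 : Num.floor (zconv f (Y0 h) (val u)) <= b0%:Z.
    by rewrite -(ler_int R); apply: le_trans (floor_le _) _; lra.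
  rewrite ffunE; move: (Num.floor _) f1 f2 => m f1 f2.
  rewrite inordK; last by lia.
  rewrite gez0_abs//; lia.
exists ({set 'I_n} * 'I_M * {ffun bd -> 'I_(b0 + b0).+1})%type.
exists (finset.setX (finset.setX [set J1 : {set 'I_n} | #|J1| == k]%SET [set: 'I_M]%SET)
  [set: {ffun bd -> 'I_(b0 + b0).+1}]%SET).
exists (fun h => (J h, kap (J h) (z h), cell h)); split.
- rewrite !cardsX !cardsT card_draws !card_ord card_ffun card_ord.
  by rewrite -cardfE.
- move=> h; rewrite !inE /= !andbT /J card_imset ?card_ord//.
  by have [_ _ _ _ [rA _]] := rhP h; exact: det_colsub_inj rA.
- move=> h h' [JE kE cE].
  (* For equal codes f sends this difference to 0 on F and to values below 1 on [bd]. Modulo Z it is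
     the difference of the lifts on C, since the two vertices differ by an integral vector there. *)
  exists (fun u => Y0 h u - Y0 h' u).
    have [_ yC _ yF _] := rhP h; have [_ yC' _ yF' _] := rhP h'.
    apply: le_trans (fB C (zcover f C) _ (fset_uniq _) (fset_uniq _) _ (@zcoverP _ f C)) _.
      by move=> u uC; rewrite yC// yC'// subrr.
    rewrite ler_pM2l// /sqsum.
    apply: (@le_trans _ _ (\sum_(u <- zcover f C) (u \in bd)%:R)).
      rewrite !big_seq; apply: ler_sum => u uN; rewrite zconvB.
      have [uF|uF] := boolP (u \in F).
        by rewrite yF// yF'// subrr expr0n.
      have ubd : u \in bd by rewrite !inE uF.
      rewrite ubd; have := cellE h [` ubd]%fset; rewrite cE cellE /=.
      move=> /addIr fE.
      have /andP[h1 h2] := floor_itv (zconv f (Y0 h) u).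
      have /andP[h3 h4] := floor_itv (zconv f (Y0 h') u).
      rewrite fE in h3 h4; rewrite intrD1 in h2 h4.
      rewrite -real_normK ?num_real// exprn_ile1// ler_norml.
      by apply/andP; split; lra.
    rewrite -natr_sum ler_nat -big_mkcond /= sum1_count -size_filter.
    apply: uniq_leq_size; first by rewrite filter_uniq ?fset_uniq.
    by move=> u; rewrite mem_filter => /andP[].
  move=> u uC.
  have [xh _ _ _ _] := rhP h; have [xh' _ _ _ _] := rhP h'.
  rewrite -xh -xh' -mod1N -mod1D; apply/mod1_eq.
  have -> : X0 h' u - X0 h u - (Y0 h u - Y0 h' u) = v h' u - v h u.
    by rewrite /v; ring.
  have iu : (index u C < size C)%N by rewrite index_mem.
  have -> : u = tnth (in_tuple C) (Ordinal iu) by rewrite (tnth_nth u) /= nth_index.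
  have [lJ|lJ] := boolP (Ordinal iu \in J h); last first.
    by apply: rpredB; apply: vint => //; rewrite -JE.
  rewrite -(proj2 (JP h)) in lJ; case/imsetP: lJ => i _ ->.
  have dZ : \det (colsub (rr (J h)) AZ) != 0.
    by have [+ _] := JP h; rewrite detAZ intr_eq0.
  rewrite -JE in kE; have [w wE] := kapP _ dZ _ _ kE.
  have dR : colsub (rr (J h)) A \in unitmx.
    by rewrite unitmxE unitfE; exact: (proj1 (JP h)).
  have : vJ h - vJ h' = map_mx intr w.
    have zP' : map_mx intr (z h') = colsub (rr (J h)) A *m vJ h' by rewrite JE zP.
    apply: (can_inj (mulKmx dR)); rewrite mulmxBr -zP -zP'.
    rewrite -map_mxB wE map_mxM AAZ map_mxsub//.
  move=> /colP/(_ i); rewrite !mxE -JE => vE.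
  by rewrite -opprB vE rpredN; apply/intrP; eexists.
Qed.

Lemma sum_option_weight (R : nzRingType) (S : finType) (t : R) :
  \sum_(a : option S) t ^+ (a != None) = 1 + t * #|S|%:R.
Proof.
rewrite (bigD1 None)//= expr0 (eq_bigr (fun=> t)); last first.
  by move=> a /negbTE an; rewrite an expr1.
by rewrite sumr_const (cardC1 (None : option S)) card_option -[X in _ + X]mulr_natr.
Qed.

(** Each point is compared with a fixed representative of its code. At most g in F their translates
    are within the Lebesgue number, so a member chosen for the representative also contains the
    translated point; at the few exceptional g a member of the cover is recorded explicitly. *)
Lemma max_minor_ge_subcover (R : realType) (G : groupType) (f : ZGamma G)
    (U : set (set (X_ R f))) :
  bounded_below R f -> bounded_below R (star f) -> finite_open_cover U ->
  exists (E : {fset G}) (b p c : nat), forall F : {fset G},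
    let C := fset_mulg E F in
    let bd := (zcover f C `\` F)%fset in
    exists2 W, subcovers (cover_join (alpha R f) F U) W &
    forall t : R, 0 < t -> t <= 1 ->
      #|` W|%:R * t ^+ (c * #|` bd|) <=
      ('C(#|` C|, #|` F|) * max_minor (star f) F * b ^ #|` bd|)%N%:R *
      (1 + t * p%:R) ^+ #|` F|.
Proof.
move=> fb fsb [Ufin Uopen Ucov].
have [E0 [d [d0 leb]]] := cover_lebesgue_number Uopen Ucov.
have [b [B [B0 fib]]] := fiber_code fb fsb.
have /finite_fsetP[Uf UE] := Ufin.
have [lebA lebAP] := @exists_choice (X_ R f) (set (X_ R f)) (fun h A =>
  U A /\ forall h' : X_ R f, (forall e, e \in E0 ->
         exists2 b : R, `|b| < d & \val h' e - \val h e = mod1 b) -> A h')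
  (fun h => let: ex_intro2 A UA AP := leb h in ex_intro _ A (conj UA AP)).
have [mem memP] : exists mem : X_ R f -> Uf, forall h, val (mem h) h.
  apply: (@exists_choice (X_ R f) Uf (fun h A => val A h)) => h.
  have : (\bigcup_(A in U) A) h by rewrite Ucov.
  move=> [A UA Ah]; have AU : A \in Uf by rewrite UE in UA.
  by exists [` AU]%fset.
(* By Chebyshev, for each [e] in [E0] at most B |bd| / d^2 points g of F have a displacement of size
   at least [d] at e g. *)
pose q := (Num.truncn (B / d ^+ 2)).+1.
exists (E0 `|` finsupp (star f))%fset, b, #|` Uf|, (#|` E0| * q)%N => F C bd.
have FC g u : g \in finsupp (star f) -> u \in F -> (g * u)%g \in C.
  move=> gf uF; apply/imfset2P; exists g; last by exists u.
  by rewrite /= in_fsetU gf orbT.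
have EC e u : e \in E0 -> u \in F -> (e * u)%g \in C.
  move=> eE uF; apply/imfset2P; exists e; last by exists u.
  by rewrite /= in_fsetU eE.
have [T0 [D0 [code0 [cardD0 codeD0 codeP]]]] := fib F C FC.
rewrite -/bd in cardD0 codeP.
have l0 : lifts R f (fun=> 0).
  by move=> x; rewrite /zconv big1 ?rpred0// => g _; rewrite mulr0.
have [rep repP] : exists rep : T0 -> X_ R f, forall h, code0 (rep (code0 h)) = code0 h.
  have [t|rep repP] := @exists_choice T0 (X_ R f) (fun t h =>
      (exists h', code0 h' = t) -> code0 h = t).
    have [[h ht]|nh] := pselect (exists h', code0 h' = t); first by exists h.
    by exists (toX l0).
  by exists rep => h; apply: repP; exists h.
pose chi h : {ffun F -> option Uf} := [ffun g =>
  if `[< lebA (alpha R f (val g) (rep (code0 h))) (alpha R f (val g) h) >]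
  then None else Some (mem (alpha R f (val g) h))].
pose L := (#|` E0| * q * #|` bd|)%N.
pose Dchi := [set x : {ffun F -> option Uf} |
  (\sum_g (x g != None : nat) <= L)%N]%SET.
have chiL h : chi h \in Dchi.
  rewrite inE; have [pp ppB ppE] := codeP _ _ (repP h).
  have bad (g : F) : ((chi h g != None) : nat)%:R <=
      \sum_(e <- E0) (pp (e * val g)%g ^+ 2 / d ^+ 2).
    have s0 : 0 <= \sum_(e <- E0) (pp (e * val g)%g ^+ 2 / d ^+ 2).
      by apply: sumr_ge0 => e _; rewrite divr_ge0 ?sqr_ge0.
    rewrite ffunE; case: asboolP => //= nleb.
    have [e eE ed] : exists2 e, e \in E0 & d <= `|pp (e * val g)%g|.
      apply: contra_notP nleb => ne; apply: (proj2 (lebAP _)) => e eE.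
      exists (pp (e * val g)%g).
        by rewrite ltNge; apply/negP => ed; apply: ne; exists e.
      by rewrite /= -ppE// EC// (valP g).
    rewrite (big_rem e)//= ler_wpDr//.
      by apply: sumr_ge0 => e' _; rewrite divr_ge0 ?sqr_ge0.
    rewrite ler_pdivlMr ?exprn_gt0// mul1r -[leRHS]real_normK ?num_real//.
    by apply: lerXn2r; rewrite ?nnegrE // ltW.
  rewrite -(ler_nat R) natr_sum; apply: (le_trans (ler_sum _ (fun g _ => bad g))).
  rewrite exchange_big /=.
  apply: (@le_trans _ _ (\sum_(e <- E0) (B / d ^+ 2) * #|` bd|%:R)).
    rewrite !big_seq; apply: ler_sum => e eE.
    rewrite -mulr_suml mulrAC ler_wpM2r ?invr_ge0 ?sqr_ge0//.
    apply: le_trans ppB.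
    pose y u := if u \in C then pp u ^+ 2 else 0.
    have yC u : u \notin C -> y u = 0 by rewrite /y => /negbTE ->.
    have yge0 u : `|y u| = y u.
      by rewrite ger0_norm// /y; case: ifP => // _; rewrite sqr_ge0.
    have uN : uniq [seq (e * u)%g | u <- F].
      by rewrite map_inj_uniq ?fset_uniq//; exact: mulgI.
    have := sum_norm_subset uN (fset_uniq C) yC.
    rewrite big_map; congr (_ <= _).
      rewrite big_seq_fsetE /=; apply: eq_bigr => u _.
      by rewrite yge0 /y EC// (valP u).
    by rewrite /sqsum; apply: eq_big_seq => u uC; rewrite yge0 /y uC.
  rewrite big_const_seq count_predT iter_addr_0 -[leLHS]mulr_natl /L !natrM -[leRHS]mulrA.
  apply: ler_wpM2l => //; apply: ler_wpM2r => //.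
  exact/ltW/truncnS_gt.
pose D := finset.setX D0 Dchi.
have [||W Wcov WD] := @coded_subcover _ (cover_join (alpha R f) F U) _ D
    (fun h => (code0 h, chi h)).
- by move=> h; rewrite inE /= codeD0 chiL.
- move=> [t0 x] _.
  pose c g := if insub g is Some g' then
    (if (x : {ffun F -> option Uf}) g' is Some A then val A
     else lebA (alpha R f g (rep t0))) else setT.
  exists (\bigcap_(g in [set` F]) (alpha R f g @^-1` c g)).
    exists c => //= g gF; rewrite /c insubT /=; case: (x _) => [A|].
      by rewrite UE; exact: valP.
    exact: (proj1 (lebAP _)).
  move=> h [h1 h2] g /= gF; rewrite /c insubT /= -h2 -h1 ffunE /=.
  by case: asboolP => // _; exact: memP.
exists W => // t t0 t1.
apply: (@le_trans _ _ (#|D|%:R * t ^+ L)).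
  by apply: ler_wpM2r; rewrite ?ler_nat// exprn_ge0// ltW.
rewrite cardsX natrM -mulrA -cardD0 ler_wpM2l//.
have := weighted_count F (fun a : option Uf => (a != None : nat)) L t0 t1.
by rewrite sum_option_weight -!cardfE.
Qed.

(** * Entropy *)

Definition join_rate (R : realType) (G : groupType) (X : Type)
    (a : G -> X -> X) (F : {fset G}) (U : set (set X)) : R :=
  ln (cover_number R (cover_join a F U)) / #|` F|%:R.
Arguments join_rate R {G X} a F U.

Definition minor_rate (R : realType) (G : groupType) (f : ZGamma G)
    (F : {fset G}) : R := ln (max_minor f F)%:R / #|` F|%:R.
Arguments minor_rate R {G} f F.

(* A divergent limn is the default point 0, hence the hypothesis 0 <= L. *)
Lemma htop_eq (R : realType) (G : groupType) (X : topologicalType)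
    (F : nat -> {fset G}) (a : G -> X -> X) (L : R) : 0 <= L ->
  (forall U, finite_open_cover U -> forall e, 0 < e ->
     \forall n \near \oo, join_rate R a (F n) U <= L + e) ->
  (exists2 U, finite_open_cover U & forall e, 0 < e ->
     \forall n \near \oo, L <= join_rate R a (F n) U + e) ->
  htop R F a = L%:E.
Proof.
move=> L0 up [U0 U0cov lo]; apply/eqP; rewrite eq_le; apply/andP; split.
  apply: ge_ereal_sup => _ [U Ucov <-]; rewrite /cover_entropy.
  have [cv|dv] := pselect (cvgn (fun n => (join_rate R a (F n) U)%:E)).
    apply/lee_addgt0Pr => e e0; apply: lime_le => //.
    by apply: filterS (up U Ucov e e0) => n; rewrite -EFinD lee_fin.
  by rewrite dvgP// lee_fin.
apply: ereal_sup_ubound; exists U0 => //; rewrite /cover_entropy.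
apply: cvg_lim => //; apply/fine_cvgP; split; first exact: nearW.
apply/cvgrPdist_le => e e0.
apply: filterS2 (up U0 U0cov e e0) (lo e e0) => n h1 h2.
by rewrite ler_norml /= -/(join_rate R a (F n) U0); apply/andP; split; lra.
Qed.

Lemma zcover_fset_mulg (G : groupType) (f : ZGamma G) (F : {fset G}) :
  zcover f F = fset_mulg (finsupp f) F.
Proof. by congr fset_mulg; apply/fsetP => x; rewrite !inE. Qed.

Lemma inner_bd_small (R : realType) (G : groupType) (f : ZGamma G)
    (F : nat -> {fset G}) (d : R) : left_folner R F -> 0 < d ->
  \forall n \near \oo, #|` inner_bd f (F n)|%:R <= d * #|` F n|%:R.
Proof.
move=> folF d0; pose K := finsupp f.
pose K' := fset_mulg [fset (k^-1)%g | k in K]%fset K.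
have d'0 : 0 < d / (#|` K|%:R + 1) by rewrite divr_gt0// ltr_wpDl.
apply: filterS (folner_small K' folF d'0) => n.
set B := (fset_mulg _ _ `\` _)%fset => hB.
apply: (@le_trans _ _ (#|` K| * #|` B|)%N%:R).
  rewrite ler_nat -(size_allpairs (fun g y => g * y)%g K B).
  apply: uniq_leq_size; first exact: fset_uniq.
  (* A point x of the boundary has some g^-1 x outside F, and g^-1 x lies in K^-1 K F; so x is g
     times a point of [B]. *)
  move=> x; rewrite !inE /= => /andP[xN /allPn[g gK gx]].
  apply/allpairsP; exists (g, g^-1 * x)%g; split=> //=; last by rewrite mulVKg.
  rewrite in_fsetD gx /= /K' -fset_mulgA; apply/imfset2P; exists (g^-1)%g.
    by apply/imfsetP; exists g.
  by exists x => //; rewrite -zcover_fset_mulg.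
rewrite natrM; apply: (@le_trans _ _ (#|` K|%:R * (d / (#|` K|%:R + 1) * #|` F n|%:R))).
  by apply: ler_wpM2l.
rewrite mulrA; apply: ler_wpM2r => //.
rewrite mulrCA ger_pMr// ler_pdivrMr ?ltr_wpDl// mul1r.
by rewrite lerDl.
Qed.

Lemma minor_rate_le_join_rate (R : realType) (G : groupType) (f : ZGamma G)
    (F : nat -> {fset G}) : left_folner R F -> solvable R f -> bounded_below R f ->
  exists2 U, finite_open_cover U & forall e, 0 < e ->
    \forall n \near \oo, minor_rate R f (F n) <= join_rate R (alpha R f) (F n) U + e.
Proof.
move=> folF fs fb; have [N [B [N0 NB]]] := max_minor_le_subcover fs.
have [F0 _] := folF.
exists (arcs R f N); first exact: arcs_finite_open_cover.
move=> e e0.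
(* With t = exp (- s) the factor t^(B |F|) costs at most e/2 per point of F. Only then is [d]
   chosen, so that the boundary factor costs the other e/2. *)
pose s := e / (2 * (B%:R + 1)).
have s0 : 0 < s by rewrite divr_gt0// mulr_gt0// ltr_wpDl.
have Bs : B%:R * s <= e / 2.
  have -> : s = e / 2 / (B%:R + 1) by rewrite /s invfM mulrA.
  rewrite mulrCA ger_pMr ?divr_gt0// ler_pdivrMr ?ltr_wpDl// mul1r.
  by rewrite lerDl.
pose t := expR (- s); have t0 : 0 < t := expR_gt0 _.
have t1 : t < 1 by rewrite expR_lt1 oppr_lt0.
pose q := 2 / (1 - t).
have q0 : 0 < q by rewrite divr_gt0// subr_gt0.
have q1 : 1 <= q by rewrite ler_pdivlMr ?subr_gt0//; lra.
have lq : 0 <= ln q by exact: ln_ge0.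
pose d := e / 2 / (ln q + 1).
have d0 : 0 < d by rewrite !divr_gt0// ltr_wpDl.
have dq : d * ln q <= e / 2.
  rewrite /d mulrAC -mulrA ger_pMr ?divr_gt0// ler_pdivrMr ?ltr_wpDl// mul1r.
  by rewrite lerDl.
apply: filterS (inner_bd_small f folF d0) => n bdn.
have Fn : (0 : R) < #|` F n|%:R by rewrite ltr0n cardfs_gt0.
have [M0 _ _ _] := max_minor_lgram fb (fset_uniq (F n)).
have MR : (0 : R) < (max_minor f (F n))%:R by rewrite ltr0n.
pose bd := #|` inner_bd f (F n)|.
pose c := (max_minor f (F n))%:R * t ^+ (B * #|` F n|) / q ^+ bd.
have c0 : 0 < c by rewrite divr_gt0 ?mulr_gt0 ?exprn_gt0.
have [fin _ cov] := arcs_finite_open_cover R f N0.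
have [W0 W0c] := join_subcovers_neq0 (alpha R f) (F n) fin cov.
have cN : c <= cover_number R (cover_join (alpha R f) (F n) (arcs R f N)).
  apply: (cover_number_ge W0c) => W Wc.
  by rewrite ler_pdivrMr ?exprn_gt0//; exact: NB.
have : ln c <= ln (cover_number R (cover_join (alpha R f) (F n) (arcs R f N))).
  by rewrite ler_ln ?posrE// (lt_le_trans c0).
rewrite /c ln_div ?posrE ?mulr_gt0 ?exprn_gt0// lnM ?posrE ?exprn_gt0//.
rewrite !lnXn// expRK -[(- s) *+ _]mulr_natr -[ln q *+ _]mulr_natr natrM => h.
rewrite /minor_rate /join_rate ler_pdivrMr// mulrDl divfK ?gt_eqF//.
have h1 : ln q * bd%:R <= e / 2 * #|` F n|%:R.
  apply: (@le_trans _ _ (ln q * (d * #|` F n|%:R))); first exact: ler_wpM2l.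
  by rewrite mulrA [ln q * d]mulrC; apply: ler_wpM2r => //; exact: ltW.
have h2 : s * (B%:R * #|` F n|%:R) <= e / 2 * #|` F n|%:R.
  by rewrite mulrA [s * _]mulrC; apply: ler_wpM2r => //; exact: ltW.
by move: h; rewrite mulNr; lra.
Qed.

Lemma join_rate_le_minor_rate (R : realType) (G : groupType) (f : ZGamma G)
    (F : nat -> {fset G}) (U : set (set (X_ R f))) :
  left_folner R F -> bounded_below R f -> bounded_below R (star f) ->
  finite_open_cover U -> forall e, 0 < e ->
    \forall n \near \oo,
      join_rate R (alpha R f) (F n) U <= minor_rate R (star f) (F n) + e.
Proof.
have arith (e k x w u y m z p : R) : x <= w -> w + u <= y + m + z + p ->
    y <= e / 4 * k -> p <= e / 4 * k -> z - u <= e / 4 * k -> 0 < e * k ->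
    x <= m + e * k by lra.
move=> folF fb fsb Ucov e e0; have [F0 _] := folF.
have [E [b [p [c H]]]] := max_minor_ge_subcover fb fsb Ucov.
have e4 : 0 < e / 4 by rewrite divr_gt0.
pose t := Num.min 1 (e / 4 / (p%:R + 1)).
have t0 : 0 < t by rewrite lt_min ltr01 divr_gt0// ltr_wpDl.
have t1 : t <= 1 by rewrite ge_min lexx.
have tp : t * p%:R <= e / 4.
  apply: (@le_trans _ _ (t * (p%:R + 1))); first by rewrite ler_pM2l// lerDl.
  by rewrite -ler_pdivlMr ?ltr_wpDl// ge_min lexx orbT.
have lt0 : ln t <= 0 by exact: ln_le0.
(* The logarithmic cost of one boundary point; [b.+1] replaces [b] to keep the logarithm meaningful
   when [b] is 0. *)
pose Q := ln (b.+1%:R : R) + c%:R * - ln t.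
have Q0 : 0 <= Q.
  by rewrite addr_ge0 ?ln_ge0 ?ler1n// mulr_ge0// oppr_ge0.
pose d := e / 4 / (Q + 1).
have d0 : 0 < d by rewrite divr_gt0// ltr_wpDl.
have dQ : Q * d <= e / 4.
  rewrite /d mulrCA ger_pMr// ler_pdivrMr ?ltr_wpDl// mul1r.
  by rewrite lerDl.
have [d1 d10 binP] := ln_binomial_small e4.
apply: filterS2 (folner_small E folF d10)
  (folner_small (fset_mulg (finsupp f) E) folF d0) => n small1 small2.
have Fn : (0 : R) < #|` F n|%:R by rewrite ltr0n cardfs_gt0.
have [M0 _ _ _] := max_minor_lgram fsb (fset_uniq (F n)).
have MR : (0 : R) < (max_minor (star f) (F n))%:R by rewrite ltr0n.
have [W Wc WH] := H (F n).
pose C := fset_mulg E (F n); pose bd := (zcover f C `\` F n)%fset.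
have bdE : bd = (fset_mulg (fset_mulg (finsupp f) E) (F n) `\` F n)%fset.
  by rewrite /bd zcover_fset_mulg fset_mulgA.
have l0 : lifts R f (fun=> 0).
  by move=> x; rewrite /zconv big1 ?rpred0// => g _; rewrite mulr0.
have N1 : 1 <= cover_number R (cover_join (alpha R f) (F n) U).
  apply: (cover_number_ge Wc) => W' [_ W'c]; rewrite ler1n cardfs_gt0.
  apply/negP => /eqP W'0; have : (\bigcup_(A in [set` W']) A) (toX l0) by rewrite W'c.
  by move=> [A]; rewrite /= W'0.
have NW := cover_number_le R Wc.
have W0 : (0 : R) < #|` W|%:R by apply: lt_le_trans NW; exact: lt_le_trans N1.
have h := WH t t0 t1; rewrite -/C -/bd in h.
have tb0 : 0 < t ^+ (c * #|` bd|) by rewrite exprn_gt0.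
have tp0 : 0 < 1 + t * p%:R by rewrite ltr_pwDl// mulr_ge0// ltW.
have C0 : (0 < 'C(#|` C|, #|` F n|))%N.
  rewrite lt0n; apply: contraTneq h => ->.
  by rewrite mul0n mul0r -ltNge mulr_gt0.
have CR : (0 : R) < 'C(#|` C|, #|` F n|)%:R by rewrite ltr0n.
have {}h : #|` W|%:R * t ^+ (c * #|` bd|) <=
    'C(#|` C|, #|` F n|)%:R * (max_minor (star f) (F n))%:R * b.+1%:R ^+ #|` bd| *
    (1 + t * p%:R) ^+ #|` F n|.
  apply: (le_trans h); rewrite !natrM natrX.
  apply: ler_wpM2r; first by rewrite exprn_ge0// ltW.
  apply: ler_wpM2l; first by rewrite mulr_ge0.
  by apply: lerXn2r; rewrite ?nnegrE ?ler_nat.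
have : ln (#|` W|%:R * t ^+ (c * #|` bd|)) <=
    ln ('C(#|` C|, #|` F n|)%:R * (max_minor (star f) (F n))%:R * b.+1%:R ^+ #|` bd| *
    (1 + t * p%:R) ^+ #|` F n|).
  by rewrite ler_ln ?posrE ?mulr_gt0 ?exprn_gt0// ltr0n.
have bp : (0 : R) < b.+1%:R by rewrite ltr0n.
rewrite !lnM ?posrE ?mulr_gt0 ?exprn_gt0// !lnXn//.
rewrite -[ln t *+ _]mulr_natr -[ln b.+1%:R *+ _]mulr_natr -[ln (1 + _) *+ _]mulr_natr natrM.
move=> hln.
have hC : ln 'C(#|` C|, #|` F n|)%:R <= e / 4 * #|` F n|%:R.
  apply: binP; first by rewrite -bin_gt0.
  apply: (@le_trans _ _ (#|` F n| + #|` (C `\` F n)%fset|)%N%:R).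
    rewrite ler_nat -leq_subLR cardfsD leq_sub2l//.
    by rewrite fsubset_leq_card// fsubsetIr.
  by rewrite natrD lerD2l.
have hp : ln (1 + t * p%:R) * #|` F n|%:R <= e / 4 * #|` F n|%:R.
  apply: ler_wpM2r; first exact: ltW.
  apply: le_trans tp; apply: le_ln1Dx.
  by apply: lt_le_trans (mulr_ge0 (ltW t0) (ler0n _ _)); rewrite oppr_lt0.
have hbd : Q * #|` bd|%:R <= e / 4 * #|` F n|%:R.
  apply: (@le_trans _ _ (Q * (d * #|` F n|%:R))).
    by apply: ler_wpM2l => //; rewrite bdE.
  by rewrite mulrA; apply: ler_wpM2r => //; exact: ltW.
have hN : ln (cover_number R (cover_join (alpha R f) (F n) U)) <= ln #|` W|%:R.
  by rewrite ler_ln ?posrE// (lt_le_trans _ N1).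
rewrite /join_rate /minor_rate ler_pdivrMr// mulrDl divfK ?gt_eqF//.
have QE : Q * #|` bd|%:R = ln b.+1%:R * #|` bd|%:R - ln t * (c%:R * #|` bd|%:R).
  by rewrite /Q; ring.
have eF : 0 < e * #|` F n|%:R by exact: mulr_gt0.
rewrite QE in hbd.
exact: arith hN hln hC hp hbd eF.
Qed.

Theorem corollary9p2 (R : realType) (G : groupType)
    (countG : countable [set: G]%classic) (amenG : amenable R G)
    (f : ZGamma G) (f_inv : invertible_in_LGamma R f)
    (F : nat -> {fset G}) (folF : left_folner R F) :
  htop R F (alpha R f) = htop R F (alpha R (star f)).
Proof.
have [fs fss] := invertible_solvable f_inv.
have fsb := solvable_bounded_below fs.
have fb := solvable_bounded_below fss; rewrite star_star in fb.
have fb' : bounded_below R (star (star f)) by rewrite star_star.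
have [L L0 FL] := max_minor_cvg fb folF.
have [U Ucov Ulo] := minor_rate_le_join_rate folF fs fb.
have [V Vcov Vlo] := minor_rate_le_join_rate folF fss fsb.
have up1 := join_rate_le_minor_rate folF fb fsb.
have up2 (V' : set (set (X_ R (star f)))) : finite_open_cover V' ->
    forall e, 0 < e -> \forall n \near \oo,
      join_rate R (alpha R (star f)) (F n) V' <= minor_rate R f (F n) + e.
  move=> V'cov e e0; have := join_rate_le_minor_rate folF fsb fb' V'cov e0.
  by rewrite star_star.
have cv e : 0 < e -> \forall n \near \oo, `|minor_rate R f (F n) - L| <= e.
  exact: FL.
rewrite (@htop_eq _ _ _ _ _ L)//; first last.
- exists U => // e e0; have e2 : 0 < e / 2 by rewrite divr_gt0.
  apply: filterS2 (Ulo _ e2) (cv _ e2) => n h1.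
  by rewrite ler_norml => /andP[h2 h3]; lra.
(* Writing m for [minor_rate] and c for [join_rate], up to e/4 at each step: c_f(U') <= m_f* <=
   c_f*(V) <= m_f <= L. Convergence of the minor rates is thus used for f alone. *)
- move=> U' U'cov e e0; have e4 : 0 < e / 4 by rewrite divr_gt0.
  apply: filterS3 (up1 U' U'cov _ e4) (Vlo _ e4)
    (filterI (up2 V Vcov _ e4) (cv _ e4)) => n h1 h2 [h3].
  by rewrite ler_norml => /andP[h4 h5]; lra.
rewrite (@htop_eq _ _ _ _ _ L)//.
- move=> V' V'cov e e0; have e2 : 0 < e / 2 by rewrite divr_gt0.
  apply: filterS2 (up2 V' V'cov _ e2) (cv _ e2) => n h1.
  by rewrite ler_norml => /andP[h2 h3]; lra.
(* The chain in the other direction, again with e/4 at each step: L <= m_f <= c_f(U) <= m_f* <=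
   c_f*(V). *)
exists V => // e e0; have e4 : 0 < e / 4 by rewrite divr_gt0.
apply: filterS3 (Vlo _ e4) (up1 U Ucov _ e4)
  (filterI (Ulo _ e4) (cv _ e4)) => n h1 h2 [h3].
by rewrite ler_norml => /andP[h4 h5]; lra.
Qed.
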